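(* Let $K$ be a number field, $n\ge2$, and $a\in\mathcal{O}_K$ such that $x^n-a$ is irreducible in $K[x]$. Let $\mathfrak{p}$ be a prime of $K$ of residue characteristic $p$ (any prime, including $2$) with $\mathfrak{p}\mid(a)$ and $p\nmid\gcd(v_{\mathfrak{p}}(a),n)$, and let $\pi_{\mathfrak{p}}\in\mathcal{O}_K$ with $v_{\mathfrak{p}}(\pi_{\mathfrak{p}})=1$. Let \[y^{\gcd(v_{\mathfrak{p}}(a),n)}-\overline{a/\pi_{\mathfrak{p}}^{v_{\mathfrak{p}}(a)}}=\gamma_1(y)\cdots\gamma_r(y)\] be the factorization into irreducibles in $k_{\mathfrak{p}}[y]$, where $k_{\mathfrak{p}}=\mathcal{O}_K/\mathfrak{p}$ and the bar denotes reduction modulo $\mathfrak{p}$. Then in $K(\sqrt[n]{a})$ \[\mathfrak{p}=\mathfrak{P}_1^{n/\gcd(v_{\mathfrak{p}}(a),n)}\cdots\mathfrak{P}_r^{n/\gcd(v_{\mathfrak{p}}(a),n)}\] with distinct prime ideals $\mathfrak{P}_i$, where $\mathfrak{P}_i$ has residue class degree $\deg\gamma_i$ over $\mathfrak{p}$.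
   Context: $v_{\mathfrak{p}}$ is the $\mathfrak{p}$-adic valuation; $a/\pi_{\mathfrak{p}}^{v_{\mathfrak{p}}(a)}$ is a $\mathfrak{p}$-adic unit; $\sqrt[n]{a}$ is any root of $x^n-a$. *)

(* Defs.v *)
From HB Require Import structures.
From mathcomp Require Import all_boot all_order all_algebra all_field.
From mathcomp Require Import boolp classical_sets.

Set Implicit Arguments.
Unset Strict Implicit.
Unset Printing Implicit Defensive.

Import GRing.Theory.
Local Open Scope ring_scope.
Local Open Scope quotient_scope.

Definition integral_pred (F : fieldType) : {pred F} :=
  [pred x | `[< integralOver (intr : int -> F) x >]].

Fact integral_pred_subring (F : fieldType) : subring_closed (@integral_pred F).
Proof.
split=> [|x y /asboolP hx /asboolP hy|x y /asboolP hx /asboolP hy]; apply/asboolP.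
- exact: integral1.
- exact: integral_sub.
- exact: integral_mul.
Qed.

HB.instance Definition _ (F : fieldType) :=
  GRing.isSubringClosed.Build F (@integral_pred F) (@integral_pred_subring F).

(* Defined for any field F, as the integral closure of the image of Z in F. *)
Record ringOfIntegers (F : fieldType) := RingOfIntegers {
  roi_val :> F;
  _ : roi_val \in @integral_pred F
}.

Section RingOfIntegers.
Variable F : fieldType.
HB.instance Definition _ := [isSub for @roi_val F].
HB.instance Definition _ := [Choice of ringOfIntegers F by <:].
HB.instance Definition _ := [SubChoice_isSubComNzRing of ringOfIntegers F by <:].
End RingOfIntegers.

Fact integral_pred_map (F E : fieldType) (f : {rmorphism F -> E})
    (x : ringOfIntegers F) :
  f (val x) \in @integral_pred E.
Proof.
apply/asboolP; case: (asboolP _ (valP x)) => q qm qx.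
exists q => //.
have -> : map_poly (intr : int -> E) q = map_poly f (map_poly intr q).
  by rewrite -map_poly_comp; apply: eq_map_poly => i /=; rewrite rmorph_int.
exact: rmorph_root.
Qed.

Section Map.
Variables (F E : fieldType) (f : {rmorphism F -> E}).

Definition roi_map (x : ringOfIntegers F) : ringOfIntegers E :=
  RingOfIntegers (integral_pred_map f x).

Fact roi_map_zmod : zmod_morphism roi_map.
Proof. by move=> x y; apply: val_inj; rewrite /= rmorphB. Qed.
Fact roi_map_monoid : monoid_morphism roi_map.
Proof.
by split=> [|x y]; apply: val_inj; rewrite /= ?rmorph1 ?rmorphM.
Qed.
HB.instance Definition _ :=
  GRing.isZmodMorphism.Build (ringOfIntegers F) (ringOfIntegers E) roi_map roi_map_zmod.
HB.instance Definition _ :=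
  GRing.isMonoidMorphism.Build (ringOfIntegers F) (ringOfIntegers E) roi_map roi_map_monoid.
End Map.

Section IdealOperations.
Variable R : comNzRingType.

(* Ideals are multiplied as plain predicates: the library's [idealr] excludes
   the unit ideal. *)
Definition idealM (I J : {pred R}) : {pred R} :=
  [pred x | `[< exists2 s : seq (R * R),
      all (fun u => (u.1 \in I) && (u.2 \in J)) s
    & x = \sum_(u <- s) u.1 * u.2 >]].

Definition ideal1 : {pred R} := predT.

Definition idealX (I : {pred R}) (n : nat) : {pred R} := iter n (idealM I) ideal1.

(* The ideal of S generated by the image of I under f. *)
Definition idealExt (S : comNzRingType) (f : R -> S) (I : {pred R}) : {pred S} :=
  [pred x | `[< exists2 s : seq (S * R),
      all (fun u => u.2 \in I) s
    & x = \sum_(u <- s) u.1 * f u.2 >]].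

End IdealOperations.

Arguments ideal1 {R}.

(* A prime of F is a nonzero prime ideal of its ring of integers. *)
Record primeOf (F : fieldType) := PrimeOf {
  prime_ideal :> prime_idealr (ringOfIntegers F);
  prime_ideal_neq0 : exists2 x, x \in (prime_ideal : {pred _}) & x != 0
}.

Definition residueField (F : fieldType) (P : primeOf F) := {ideal_quot P}.

Section ResidueField.
Variables (F : fieldType) (P : primeOf F).

HB.instance Definition _ := GRing.ComNzRing.on (residueField P).

Definition residue : ringOfIntegers F -> residueField P := \pi_(residueField P).
HB.instance Definition _ := GRing.RMorphism.on residue.

Fact residue_eq0 x : (residue x == 0) = (x \in (P : {pred _})).
Proof. by rewrite -[0](rmorph0 residue) /residue -Quotient.idealrBE subr0. Qed.


Fact roi_root (x : ringOfIntegers F) :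
  exists2 q : {poly int}, q \is monic & root (map_poly intr q) x.
Proof.
case: (asboolP _ (valP x)) => q qm /eqP qx; exists q => //.
apply/eqP/val_inj; rewrite -horner_map -map_poly_comp -[RHS]qx.
by congr (_.[_]); apply: eq_map_poly => i; exact: (rmorph_int val).
Qed.

Fact residue_mulf (x y : residueField P) : x * y = 0 -> x = 0 \/ y = 0.
Proof.
by move=> /(@Quotient.rquot_IdomainAxiom _ P)/orP[]/eqP; [left | right].
Qed.

Fact monic_cons (p : {poly int}) c :
  p * 'X + c%:P \is monic -> p != 0 -> p \is monic.
Proof.
move=> pm p0; move: pm; rewrite !monicE lead_coefDl ?lead_coefMX //.
by rewrite size_mulX // (leq_ltn_trans (size_polyC_leq1 c)) // ltnS size_poly_gt0.
Qed.

Fact horner_cons (S : comNzRingType) (p : {poly int}) c (x : S) :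
  (map_poly intr (p * 'X + c%:P)).[x] = (map_poly intr p).[x] * x + c%:~R.
Proof. by rewrite rmorphD rmorphM /= map_polyX map_polyC !hornerE. Qed.

Fact roi_mulf (x y : ringOfIntegers F) : x * y = 0 -> y != 0 -> x = 0.
Proof.
move=> /(congr1 val)/eqP; rewrite rmorphM [val 0]rmorph0 mulf_eq0 => xy y0.
apply: val_inj; rewrite [RHS]rmorph0; case/orP: xy => /eqP // vy.
by case/eqP: y0; apply: val_inj; rewrite vy [RHS]rmorph0.
Qed.

Fact residue_char : exists2 N : nat, (0 < N)%N & N%:R = 0 :> residueField P.
Proof.
suff [c c0 cP] : exists2 c : int, c != 0 & c%:~R = 0 :> residueField P.
  exists `|c|%N; first by rewrite absz_gt0.
  by case: c cP {c0} => m //= /eqP; rewrite oppr_eq0 => /eqP.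
have [x Px x0] := prime_ideal_neq0 P; have [q] := roi_root x.
elim/poly_ind: q => [|p c IHp]; first by rewrite monicE lead_coef0.
move=> qm; rewrite /root horner_cons; have [c0|c0] := eqVneq c 0 => qx.
  have px : root (map_poly intr p) x.
    by apply/eqP/roi_mulf/x0; apply/eqP; move: qx; rewrite c0 addr0.
  apply: IHp => //; apply: (monic_cons qm); apply/eqP => p0.
  by move: qm; rewrite p0 c0 mul0r add0r monicE lead_coef0.
exists c => //; apply/eqP; rewrite -(rmorph_int residue) residue_eq0.
move: qx; rewrite addrC addr_eq0 => /eqP ->.
by rewrite rpredN idealMr.
Qed.

Fact residue_int_inv (c : int) :
  c%:~R != 0 :> residueField P -> exists d, d * c%:~R = 1 :> residueField P.
Proof.
move=> c0; have [N0 N0gt0 N0P] := residue_char.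
have exN : exists N, (0 < N)%N && (N%:R == 0 :> residueField P).
  by exists N0; rewrite N0gt0 N0P eqxx.
case: (ex_minnP exN) => N /andP[Ngt0 /eqP N_0] Nmin.
have [u [v uv]] := Bezoutz c N.
have guv : (gcdz c N)%:~R = u%:~R * c%:~R :> residueField P.
  by rewrite -uv rmorphD !rmorphM /= -pmulrn N_0 mulr0 addr0.
exists u%:~R; rewrite -guv.
suff -> : gcdz c N = 1 by [].
have /dvdnP[h Nh] : (gcdn `|c| N %| N)%N by exact: dvdn_gcdr.
move: N_0; rewrite {1}Nh natrM => /residue_mulf[] h0.
  have hgt0 : (0 < h)%N by move: Ngt0; rewrite Nh muln_gt0 => /andP[].
  have /Nmin hN : (0 < h)%N && (h%:R == 0 :> residueField P) by rewrite hgt0 h0 eqxx.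
  have g0 : (0 < gcdn `|c| N)%N by rewrite gcdn_gt0 Ngt0 orbT.
  have g1 : (gcdn `|c| N <= 1)%N by rewrite -(leq_pmul2l hgt0) -Nh muln1.
  by rewrite /gcdz /=; congr Posz; apply/eqP; rewrite eqn_leq g1 g0.
have /dvdzP[k ck] : (gcdz c N %| c)%Z by exact: dvdz_gcdl.
by case/eqP: c0; rewrite ck rmorphM /= /gcdz -pmulrn h0 mulr0.
Qed.

Fact residue_has_inv (y : residueField P) : y != 0 -> exists z, z * y = 1.
Proof.
move=> y0; have [x xy] : exists x, residue x = y.
  by exists (repr y); rewrite /residue reprK.
have [q qm qx] := roi_root x.
have {qx}: (map_poly intr q).[y] = 0.
  rewrite -xy -(rmorph0 residue) -(rootP qx) -horner_map -map_poly_comp.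
  by congr (_.[_]); apply: eq_map_poly => i /=; rewrite (rmorph_int residue).
elim/poly_ind: q qm => [|p c IHp]; first by rewrite monicE lead_coef0.
move=> qm; rewrite horner_cons.
have [c0|/residue_int_inv[d dc] /eqP] := eqVneq (c%:~R : residueField P) 0.
  rewrite c0 addr0 => /residue_mulf[px|/eqP]; last by rewrite (negPf y0).
  move: px; apply: IHp; apply: (monic_cons qm); apply/eqP => p0; move: qm c0.
  rewrite p0 mul0r add0r monicE lead_coefC => /eqP-> /eqP.
  by rewrite oner_eq0.
rewrite addrC addr_eq0 => /eqP cE; exists (- (d * (map_poly intr p).[y])).
by rewrite mulNr -mulrA -mulrN -cE.
Qed.

Definition residue_inv (y : residueField P) := xget 0 [set z | z * y = 1].

Fact residue_mulVf y : y != 0 -> residue_inv y * y = 1.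
Proof. by move=> /residue_has_inv[z zy]; exact: (@xgetPex _ 0 [set z | z * y = 1] (ex_intro _ z zy)). Qed.

Fact residue_inv0 : residue_inv 0 = 0.
Proof.
apply: xgetPN => z; rewrite /= mulr0 => /esym/eqP.
by rewrite oner_eq0.
Qed.

HB.instance Definition _ :=
  GRing.ComNzRing_isField.Build (residueField P) residue_mulVf residue_inv0.

End ResidueField.

(* The powers of [P] decrease, so this is the largest [v] such that
   [a \in P ^ v]. In a number field the junk value 0 is taken for [a = 0] only. *)
Definition valuation (F : fieldType) (P : primeOf F) (a : ringOfIntegers F) : nat :=
  xget 0%N [set v | a \in idealX (P : {pred _}) v
                    /\ a \notin idealX (P : {pred _}) v.+1].

(* Reduction modulo [P] on the localization of the ring of integers at [P],
   i.e. on the x = s / t with s, t integers and t not in [P] (junk value 0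
   elsewhere). *)
Definition reduce (F : fieldType) (P : primeOf F) (x : F) : residueField P :=
  xget 0 [set y | exists s t : ringOfIntegers F,
    [/\ t \notin (P : {pred _}), x = val s / val t & y = residue P s / residue P t]].

Fact reduceE (F : fieldType) (P : primeOf F) (s t : ringOfIntegers F) :
  t \notin (P : {pred _}) -> reduce P (val s / val t) = residue P s / residue P t.
Proof.
move=> tP; rewrite /reduce; set A : set _ := (X in xget _ X).
suff uA y : A y -> y = residue P s / residue P t by apply: xget_unique => //; exists s, t.
have nz u : u \notin (P : {pred _}) -> residue P u != 0 /\ val u != 0.
  move=> uP; split; first by rewrite residue_eq0.
  apply: contraNneq uP => u0; have -> : u = 0 by apply: val_inj; rewrite u0 [RHS]rmorph0.
  exact: rpred0.
case=> s' [t' [t'P st ->]]; have [[nt vt] [nt' vt']] := (nz t tP, nz t' t'P).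
apply/eqP; rewrite eqr_div // -!rmorphM; apply/eqP; congr (residue P _).
by apply: val_inj; rewrite !rmorphM; apply/eqP; rewrite -eqr_div // st.
Qed.

Section ResidueExtension.
Variables (F E : fieldType) (f : {rmorphism F -> E}).
Variables (p : primeOf F) (P : primeOf E).

Definition lies_over :=
  forall x, (roi_map f x \in (P : {pred _})) = (x \in (p : {pred _})).

(* The proof of [lies_over] is what makes this a ring morphism. *)
Definition residue_map (h : lies_over) (x : residueField p) : residueField P :=
  residue P (roi_map f (repr x)).

Fact residue_mapE h x : residue_map h (residue p x) = residue P (roi_map f x).
Proof.
apply/eqP; rewrite -subr_eq0 -!rmorphB residue_eq0 h -residue_eq0 rmorphB subr_eq0.
by apply/eqP; exact: reprK.
Qed.

Section Morphism.
Hypothesis h : lies_over.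

Fact residue_map_zmod : zmod_morphism (residue_map h).
Proof.
move=> x y; rewrite -[x]reprK -[y]reprK -!/(residue p _) -rmorphB.
by rewrite !residue_mapE !rmorphB.
Qed.

Fact residue_map_monoid : monoid_morphism (residue_map h).
Proof.
split=> [|x y]; first by rewrite -(rmorph1 (residue p)) residue_mapE !rmorph1.
rewrite -[x]reprK -[y]reprK -!/(residue p _) -rmorphM.
by rewrite !residue_mapE !rmorphM.
Qed.

HB.instance Definition _ := GRing.isZmodMorphism.Build
  (residueField p) (residueField P) (residue_map h) residue_map_zmod.
HB.instance Definition _ := GRing.isMonoidMorphism.Build
  (residueField p) (residueField P) (residue_map h) residue_map_monoid.

End Morphism.

End ResidueExtension.

(* The field extension [f : k -> l] has degree [d]. *)
Definition has_degree (k l : fieldType) (f : {rmorphism k -> l}) (d : nat) :=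
  exists b : 'I_d -> l, forall y : l,
    exists! c : {ffun 'I_d -> k}, y = \sum_i f (c i) * b i.

(* Main.v *)
(* Let v be the valuation at the prime, d = gcd(v(a), n), m = n / d and
   e = v(a) / d. Giving alpha the weight e and a uniformizer pi of the prime the
   weight m is compatible with alpha ^ n = a, so K[X] and its quotient L are
   filtered by weight. The elements of weight >= 0 modulo those of weight >= 1
   form k[y] / (y ^ d - c), where y is the class of alpha ^ m / pi ^ e and c that
   of a / pi ^ v(a). This ring is reduced since the residue characteristic does
   not divide d, hence the elements of L integral over Z have weight >= 0. The
   primes above the given one are the kernels of the maps from the ring of
   integers of L to k[y] / gamma_i. As m and e are coprime, a monomial Pi in
   alpha and pi has weight 1: up to elements prime to the given prime, Pi
   generates the intersection of these kernels, and Pi ^ m generates the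
   extension of the given prime.

   That the localization of the ring of integers of K is a discrete valuation
   ring comes from the finiteness of O_K / q O_K, where q is the residue
   characteristic: it yields c = y / q outside O_K with c p inside O_K, and the
   pigeonhole principle on the q c ^ i shows that c p is not inside p. *)

Require Import Defs.
From HB Require Import structures.
From mathcomp Require Import all_boot all_order all_algebra all_field.
From mathcomp Require Import boolp classical_sets zify.

Set Implicit Arguments.
Unset Strict Implicit.
Unset Printing Implicit Defensive.

Import Order.TTheory GRing.Theory Num.Theory.
Local Open Scope ring_scope.

(** * Products of ideals *)

Section IdealProducts.
Variable R : comNzRingType.
Implicit Types (I J : {pred R}) (x y : R).

Definition mul_stable I := forall r x, x \in I -> r * x \in I.

Lemma idealM_mul I J x y : x \in I -> y \in J -> x * y \in idealM I J.
Proof.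
move=> Ix Jy; apply/asboolP; exists [:: (x, y)]; first by rewrite /= Ix Jy.
by rewrite big_seq1.
Qed.

Lemma idealM0 I J : 0 \in idealM I J.
Proof. by apply/asboolP; exists [::]; rewrite ?big_nil. Qed.

Lemma idealMD I J x y : x \in idealM I J -> y \in idealM I J -> x + y \in idealM I J.
Proof.
move=> /asboolP[s sP ->] /asboolP[t tP ->]; apply/asboolP; exists (s ++ t).
  by rewrite all_cat sP.
by rewrite big_cat.
Qed.

Lemma idealM_ind I J (T : R -> Prop) :
    T 0 -> (forall x y, T x -> T y -> T (x + y)) ->
    (forall x y, x \in I -> y \in J -> T (x * y)) ->
  forall x, x \in idealM I J -> T x.
Proof.
move=> T0 TD TM _ /asboolP[s /allP sP ->]; rewrite big_seq.
by elim/big_rec: _ => // u x /sP/andP[Iu Ju] Tx; apply/TD/Tx/TM.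
Qed.

Lemma idealM_stable I J : mul_stable J -> mul_stable (idealM I J).
Proof.
move=> Js r; apply: idealM_ind => [|u v Tu Tv|u v Iu Jv].
- by rewrite mulr0 idealM0.
- by rewrite mulrDr idealMD.
- by rewrite mulrCA idealM_mul ?Js.
Qed.

Lemma idealM_sub I I' J J' :
  {subset I <= I'} -> {subset J <= J'} -> {subset idealM I J <= idealM I' J'}.
Proof.
move=> II JJ x; move: x; apply: idealM_ind => [|x y|x y /II ? /JJ ?]; first exact: idealM0.
  exact: idealMD.
exact: idealM_mul.
Qed.

Lemma eq_idealM I I' J J' : I =i I' -> J =i J' -> idealM I J =i idealM I' J'.
Proof.
by move=> II JJ x; apply/idP/idP; apply: idealM_sub => y; rewrite ?II ?JJ.
Qed.

Lemma idealMC I J : idealM I J =i idealM J I.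
Proof.
suff sIJ I' J' : {subset idealM I' J' <= idealM J' I'} by move=> x; apply/idP/idP; apply: sIJ.
move=> x; move: x; apply: idealM_ind => [|x y|x y Ix Jy]; first exact: idealM0.
  exact: idealMD.
by rewrite mulrC idealM_mul.
Qed.

Lemma idealMA I J T : idealM I (idealM J T) =i idealM (idealM I J) T.
Proof.
move=> x; apply/idP/idP; move: x.
  apply: idealM_ind => [|x y|x y Ix]; [exact: idealM0 | exact: idealMD |].
  move: y; apply: idealM_ind => [|u v|u v Ju Tv]; rewrite ?mulr0 ?idealM0 //.
    by rewrite mulrDr; apply: idealMD.
  by rewrite mulrA !idealM_mul.
apply: idealM_ind => [|x y|x y IJx Ty]; [exact: idealM0 | exact: idealMD |].
move: x IJx; apply: idealM_ind => [|u v|u v Ju Tv]; rewrite ?mul0r ?idealM0 //.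
  by rewrite mulrDl; apply: idealMD.
by rewrite -mulrA !idealM_mul.
Qed.

Lemma idealMACA I J I' J' :
  idealM (idealM I J) (idealM I' J') =i idealM (idealM I I') (idealM J J').
Proof.
move=> x; rewrite -idealMA (eq_idealM (frefl _) (idealMA J I' J')).
rewrite (eq_idealM (frefl _) (eq_idealM (idealMC J I') (frefl J'))).
by rewrite (eq_idealM (frefl _) (fsym (idealMA I' J J'))) idealMA.
Qed.

Lemma idealX_stable I n : mul_stable (idealX I n).
Proof. by elim: n => [|n IHn] //=; exact: idealM_stable. Qed.

Lemma idealXD I n x y : x \in idealX I n -> y \in idealX I n -> x + y \in idealX I n.
Proof. by case: n => [|n] //=; apply: idealMD. Qed.

Lemma idealX0 I n : 0 \in idealX I n.
Proof. by case: n => [|n] //; apply: idealM0. Qed.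

Lemma idealX_exp I n x : x \in I -> x ^+ n \in idealX I n.
Proof. by move=> Ix; elim: n => [|n IHn] //; rewrite exprS idealM_mul. Qed.

Lemma idealM11 : idealM (@ideal1 R) ideal1 =i ideal1.
Proof. by move=> x; rewrite [in RHS]inE -[x]mul1r; apply: idealM_mul. Qed.

(** Ideals are only compared extensionally, so associativity and commutativity enter through
    [eq_idealM]. This trades the product of prime powers for a power of the product of the primes,
    the ideal that one element generates locally. *)
Lemma idealX_prod (T : Type) (s : seq T) (I : T -> {pred R}) n :
  \big[@idealM R/ideal1]_(i <- s) idealX (I i) n
    =i idealX (\big[@idealM R/ideal1]_(i <- s) I i) n.
Proof.
elim: n => [|n IHn] /= x.
  elim: s x => [|i s IHs] x; first by rewrite big_nil.
  by rewrite big_cons (eq_idealM (frefl _) IHs) idealM11.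
rewrite -[RHS](eq_idealM (frefl _) IHn) {IHn}.
elim: s x => [|i s IHs] x; first by rewrite !big_nil idealM11.
by rewrite !big_cons (eq_idealM (frefl _) IHs) idealMACA.
Qed.

Lemma bigideal_stable (T : Type) (s : seq T) (I : T -> {pred R}) :
  (forall i, mul_stable (I i)) -> mul_stable (\big[@idealM R/ideal1]_(i <- s) I i).
Proof. by move=> Is; elim/big_rec: _ => [//|i J _]; apply: idealM_stable. Qed.

Lemma bigideal_prod (T : Type) (s : seq T) (I : T -> {pred R}) (x : T -> R) :
    (forall i, x i \in I i) ->
  \prod_(i <- s) x i \in \big[@idealM R/ideal1]_(i <- s) I i.
Proof.
by move=> Ix; elim/big_rec2: _ => [//|i y J _ Jy]; apply: idealM_mul.
Qed.

End IdealProducts.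

(* [t] is invertible modulo an ideal that contains a power of [1 - t * s]. *)
Lemma mem_cancel (R : comNzRingType) (T : {pred R}) (t s z : R) m :
    (forall x y, x \in T -> y \in T -> x + y \in T) -> mul_stable T ->
  (1 - t * s) ^+ m \in T -> t * z \in T -> z \in T.
Proof.
move=> TD TM em tz; set e := 1 - t * s in em.
have -> : z = (1 - e ^+ m) * z + e ^+ m * z by rewrite mulrBl mul1r subrK.
apply: TD; last by rewrite mulrC TM.
(* [1 - e ^+ m] is a multiple of [1 - e], that is of [t * s]. *)
rewrite -[X in X - _](expr1n _ m) subrXX /e subKr.
by rewrite [t * s]mulrC -mulrA mulrACA TM.
Qed.

(** * The local ring at a prime *)

Section FiniteResidueRing.
Variables (K : fieldExtType rat) (q : nat).
Hypothesis q_prime : prime q.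
Local Notation A := (ringOfIntegers K).

(** More than [K : Q] elements are dependent over Q, and the product [D] of the denominators clears
    the relation. *)
Lemma int_relation m (b : 'I_m -> K) : (\dim {:K} < m)%N ->
  exists2 c : 'I_m -> int, (exists i, c i != 0) & \sum_i b i *~ c i = 0.
Proof.
move=> ltm; have : ~~ free [tuple b i | i < m].
  apply: contraL ltm; rewrite /free size_tuple -leqNgt => /eqP <-.
  exact/dimvS/subvf.
move/freeP=> H.
have [k k0 [i ki]] : exists2 k : 'I_m -> rat, \sum_i k i *: b i = 0 & exists i, k i != 0.
  apply: contrapT => Hn; apply: H => k k0 i; have [//|ki] := eqVneq (k i) 0.
  exfalso; apply: Hn; exists k; last by exists i.
  by rewrite -[RHS]k0; apply: eq_bigr => j _; rewrite -tnth_nth tnth_mktuple.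
pose D := \prod_j denq (k j).
have D0 : D != 0 by apply/prodf_neq0 => j _; apply: denq_neq0.
(* The integer [D * k j], written without division. *)
pose c j := numq (k j) * \prod_(l < m | l != j) denq (k l).
have cE j : (c j)%:~R = D%:~R * k j :> rat.
  have kE : (numq (k j))%:~R = k j * (denq (k j))%:~R.
    by rewrite -[X in _ = X * _]divq_num_den divfK // intr_eq0 denq_neq0.
  by rewrite /D (bigD1 j) //= /c !rmorphM /= kE -[LHS]mulrA [LHS]mulrC.
exists c; first by exists i; rewrite -(intr_eq0 rat) cE mulf_neq0 // intr_eq0.
rewrite -[RHS](scaler0 _ D%:~R) -[in RHS]k0 scaler_sumr; apply: eq_bigr => j _.
by rewrite scalerA -cE scaler_int.
Qed.

(** As long as [q] divides all coefficients it can be divided out, K having characteristic 0; this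
    shrinks a fixed nonzero coefficient, so the process stops. *)
Lemma primitive_relation m (b : 'I_m -> K) : (\dim {:K} < m)%N ->
  exists2 c : 'I_m -> int, (exists i, ~~ (q %| c i)%Z) & \sum_i b i *~ c i = 0.
Proof.
move=> /int_relation-/(_ b)[c [i ci] cb].
move: {2}`|c i|%N (leqnn `|c i|%N) => N; elim: N c ci cb => [|N IHN] c ci cb leN.
  by move: leN ci; rewrite leqn0 absz_eq0 => ->.
have [[j cj]|cq] := pselect (exists j, ~~ (q %| c j)%Z); first by exists c => //; exists j.
have {}cq j : (q %| c j)%Z by apply/negPn/negP => cj; apply: cq; exists j.
have cE j : c j = (c j %/ q)%Z * q by rewrite divzK.
apply: (IHN (fun j => c j %/ q)%Z).
- by apply: contra_neq ci => c0; rewrite cE c0 mul0r.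
- have q0 : q%:R != 0 :> K.
    by rewrite -(rmorph_nat (in_alg K)) fmorph_eq0 pnatr_eq0 -lt0n prime_gt0.
  apply: (mulIf q0); rewrite mul0r -[RHS]cb mulr_suml; apply: eq_bigr => j _.
  by rewrite [in RHS]cE mulrzA -pmulrn mulr_natr.
rewrite -ltnS (leq_trans _ leN) // [in X in (_ < X)%N]cE abszM /=.
by rewrite ltn_Pmulr ?prime_gt1 // absz_gt0; apply: contra_neq ci => c0; rewrite cE c0 mul0r.
Qed.

(** Linear independence over Z / q of the classes of the [b i] in A / q A. *)
Definition free_mod m (b : 'I_m -> A) := forall c : 'I_m -> int,
  (exists y, \sum_i b i *~ c i = y *+ q) -> forall i, (q %| c i)%Z.

(** A primitive relation over Z remains nontrivial modulo [q]. *)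
Lemma free_mod_le m (b : 'I_m -> A) : free_mod b -> (m <= \dim {:K})%N.
Proof.
move=> bf; rewrite leqNgt; apply/negP => /primitive_relation-/(_ (fun i => val (b i))).
case=> c [i /negP ci] c0; apply: ci; apply: bf; exists 0; rewrite mul0rn.
apply: val_inj; rewrite raddf_sum [RHS]raddf0 -[RHS]c0; apply: eq_bigr => j _.
by rewrite raddfMz.
Qed.

(** A family of maximal size among those free modulo [q] spans A / q A, so its combinations with
    coefficients in [0, q) represent all classes. *)
Lemma residue_ring_reps :
  exists s : seq A, forall z : A, exists2 w, w \in s & exists y, z - w = y *+ q.
Proof.
pose P m := `[< exists b : 'I_m -> A, free_mod b >].
have P0 : exists m, P m.
  exists 0%N; apply/asboolP; exists (fun _ => 0) => c _ [] //.
have Pb m : P m -> (m <= \dim {:K})%N by move=> /asboolP[b]; apply: free_mod_le.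
case: (ex_maxnP P0 Pb) => m /asboolP[b bf] mmax.
exists [seq \sum_i b i *+ (c i : 'I_q) | c : {ffun 'I_m -> 'I_q}] => z.
(* By maximality, adjoining [z] to [b] creates a relation modulo [q]. *)
pose b' (i : 'I_m.+1) := if unlift ord0 i is Some j then b j else z.
have : ~ free_mod b'.
  by move=> b'f; have /mmax : P m.+1; [apply/asboolP; exists b' | rewrite ltnn].
move=> /existsNP[c] /not_implyP[[y yE]] /existsNP[i0 /negP ci0].
move: yE; rewrite big_ord_recl {1}/b' unlift_none => yE.
have {}yE : z *~ c ord0 + \sum_(i < m) b i *~ c (lift ord0 i) = y *+ q.
  by rewrite -yE; congr (_ + _); apply: eq_bigr => i _; rewrite /b' liftK.
(* Otherwise the relation modulo [q] would involve [b] alone, which is free. *)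
have c0 : ~~ (q %| c ord0)%Z.
  apply/negP => /dvdzP[e ce]; case/negP: ci0.
  have bq : forall i, (q %| c (lift ord0 i))%Z.
    apply: bf; exists (y - z *~ e); rewrite mulrnBl -yE ce mulrzA pmulrn.
    by rewrite addrAC subrr add0r.
  by have [j ->|->] := unliftP ord0 i0; [exact: bq | by rewrite ce dvdz_mull].
have [u [w uw]] : exists u w, u * c ord0 + w * q%:Z = 1.
  have [u [w uw]] := Bezoutz (c ord0) q; exists u, w; rewrite uw.
  congr Posz; apply/eqP; rewrite -[_ == _]/(coprime `|c ord0| q).
  by rewrite coprime_sym prime_coprime.
have q0 : q%:Z != 0 by rewrite eqz_nat -lt0n prime_gt0.
(* Multiplying the relation by [u], the inverse of [c ord0] modulo [q], gives [z] as the sum of the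
   [b i *~ e i] up to a multiple of [q]. *)
pose e i := (- u * c (lift ord0 i))%R.
have ltq i : (`|(e i %% q)%Z| < q)%N.
  by rewrite -ltz_nat gez0_abs ?modz_ge0 // -[X in _ < X]/`|q%:Z| ltz_mod.
exists (\sum_i b i *+ [ffun i => Ordinal (ltq i)] i); first exact: map_f (mem_enum _ _).
exists (z *~ w + y *~ u + \sum_i b i *~ (e i %/ q)%Z).
have -> : \sum_i b i *+ [ffun i => Ordinal (ltq i)] i = \sum_i b i *~ e i
     - (\sum_i b i *~ (e i %/ q)%Z) *+ q.
  rewrite -sumrMnl -sumrB; apply: eq_bigr => i _; rewrite ffunE /=.
  rewrite [X in _ *~ X - _](divz_eq (e i) q) mulrzDr mulrzA -pmulrn.
  by rewrite addrC addKr pmulrn gez0_abs // modz_ge0.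
rewrite opprB addrCA [LHS]addrC mulrnDl; congr (_ + _).
have -> : \sum_i b i *~ e i = (z *~ c ord0 - y *+ q) *~ u.
  rewrite -yE opprD addNKr mulNrz -mulrNz mulrz_suml; apply: eq_bigr => i _.
  by rewrite /e mulrC mulrzA.
rewrite mulrzBl opprB -mulrzA [c _ * u]mulrC -{1}[z]mulr1z -uw mulrzDr.
rewrite addrC -addrA addKr addrC mulrzA -pmulrn mulrnDl; congr (_ + _).
by rewrite !pmulrn -!mulrzA mulrC.
Qed.

Lemma pigeonhole_mod (u : nat -> A) :
  exists i j, (i < j)%N /\ exists y, u j - u i = y *+ q.
Proof.
have [s sP] := residue_ring_reps.
have /boolp.choice[f fP] k : exists w, w \in s /\ exists y, u k - w = y *+ q.
  by have [w ws wP] := sP (u k); exists w.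
have [i [j [ltij fij]]] : exists i j, (i < j)%N /\ f i = f j.
  have : ~~ injectiveb (fun k : 'I_(size s).+1 => Ordinal (etrans (index_mem _ _) (fP k).1)).
    by apply/negP => /injectiveP/leq_card; rewrite !card_ord ltnn.
  move=> /injectivePn[i [j ij]] /(congr1 val) /= fij.
  have {}fij : f i = f j by rewrite -(nth_index 0 (fP i).1) fij nth_index ?(fP j).1.
  by move: ij; rewrite -val_eqE neq_ltn => /orP[] lt; [exists i, j | exists j, i].
have [[_ [y yE]] [_ [z zE]]] := (fP j, fP i).
by exists i, j; split=> //; exists (y - z); rewrite mulrnBl -yE -zE fij opprB addrA subrK.
Qed.

End FiniteResidueRing.

(** * Invertibility modulo a prime *)

Section PrimeIdeal.
Variables (K : fieldType) (p : primeOf K).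
Local Notation A := (ringOfIntegers K).

Lemma prime_notinM (s t : A) : s \notin p -> t \notin p -> s * t \notin p.
Proof. by rewrite prime_idealrM negb_or => -> ->. Qed.

Lemma prime_mulr (s t : A) : t \in p -> s * t \in p.
Proof. exact: idealMr. Qed.

Lemma prime_mull (s t : A) : s \in p -> s * t \in p.
Proof. by rewrite mulrC; apply: idealMr. Qed.

Lemma prime_notinX (t : A) n : t \notin p -> t ^+ n \notin p.
Proof.
by move=> tp; elim: n => [|n IHn]; rewrite ?idealr1 // exprS prime_notinM.
Qed.

Lemma prime_inX (t : A) n : (0 < n)%N -> t \in p -> t ^+ n \in p.
Proof. by case: n => // n _ tp; rewrite exprS prime_mull. Qed.

Lemma residue_surj (y : residueField p) : exists x, residue p x = y.
Proof. by exists (repr y); rewrite /residue reprK. Qed.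

Lemma residueB : {morph residue p : x y / x - y}. Proof. exact: rmorphB. Qed.
Lemma residueD : {morph residue p : x y / x + y}. Proof. exact: rmorphD. Qed.
Lemma residueM : {morph residue p : x y / x * y}. Proof. exact: rmorphM. Qed.
Lemma residue1 : residue p 1 = 1. Proof. exact: rmorph1. Qed.
Lemma residue0 : residue p 0 = 0. Proof. exact: rmorph0. Qed.

Lemma prime_inv (t : A) : t \notin p -> exists s, 1 - t * s \in p.
Proof.
rewrite -residue_eq0 => t0; have [s sE] := residue_surj (residue p t)^-1.
by exists s; rewrite -residue_eq0 residueB residueM residue1 sE divff ?subrr.
Qed.

Lemma idealX1_sub : {subset idealX p 1 <= p}.
Proof.
apply: idealM_ind => [|x y|x y px _]; [exact: rpred0 | exact: rpredD |].
exact: prime_mull.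
Qed.

(** If [s] inverts [t] modulo p, then [(1 - t * s) ^+ k] lies in the power [k] of p, so [mem_cancel]
    applies. *)
Lemma mem_primeX k (t z : A) : t \notin p -> t * z \in idealX p k -> z \in idealX p k.
Proof.
move=> /prime_inv[s ts]; apply: (@mem_cancel _ _ t s _ k).
- exact: idealXD.
- exact: idealX_stable.
- exact: idealX_exp.
Qed.

End PrimeIdeal.

(** * A uniformizer generates the prime locally *)

Section Uniformizer.
Variables (K : fieldExtType rat) (p : primeOf K) (q : nat).
Hypothesis q_char : q \in [pchar (residueField p)].
Local Notation A := (ringOfIntegers K).

Lemma prime_q_char : prime q.
Proof. by case/andP: q_char. Qed.

Lemma residue_char_mem : q%:R \in p.
Proof. by rewrite -residue_eq0 rmorph_nat (pcharf0 q_char). Qed.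

Definition qdvd (x : A) := exists w, x = w *+ q.

Lemma qdvd_mull x y : qdvd y -> qdvd (x * y).
Proof. by case=> w ->; exists (x * w); rewrite mulrnAr. Qed.

Lemma qdvdD x y : qdvd x -> qdvd y -> qdvd (x + y).
Proof. by move=> [w ->] [u ->]; exists (w + u); rewrite mulrnDl. Qed.

Lemma qdvd_mem x : qdvd x -> x \in p.
Proof. by case=> w ->; rewrite -mulr_natr prime_mulr ?residue_char_mem. Qed.

(** Two powers of [z] agree modulo [q], and [z ^+ (j - i) - 1] is outside p because [z] is
    inside. *)
Lemma prime_nilpotent_mod z : z \in p -> exists k t, t \notin p /\ qdvd (t * z ^+ k).
Proof.
move=> pz; have [i [j [ltij ij]]] := pigeonhole_mod prime_q_char (fun k => z ^+ k).
exists i, (z ^+ (j - i) - 1); split; last first.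
  by rewrite mulrBl mul1r -exprD subnK // ltnW.
rewrite -subn_gt0 in ltij; apply/negP => /(rpredB (prime_inX ltij pz)).
by rewrite opprB addrCA subrr addr0 idealr1.
Qed.

(* The class of [y] spans a simple submodule of A / q A, localized at p. *)
Lemma socle_mod (s : seq A) : {subset s <= p} ->
  exists y, (forall t, t \notin p -> ~ qdvd (t * y)) /\
    exists2 t, t \notin p & forall z, z \in s -> qdvd (t * (z * y)).
Proof.
elim: s => [|z s IHs] ps.
  exists 1; split=> [t /negP tp|]; first by rewrite mulr1 => /qdvd_mem.
  by exists 1; rewrite ?idealr1.
have [x xs|y [yp [t tp ty]]] := IHs; first by apply: ps; rewrite inE xs orbT.
pose P k := `[< exists2 u, u \notin p & qdvd (u * (z ^+ k * y)) >].
have exP : exists k, P k.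
  have [|k [u [up uz]]] := @prime_nilpotent_mod z; first by apply: ps; rewrite inE eqxx.
  by exists k; apply/asboolP; exists u; rewrite // mulrA mulrC; apply: qdvd_mull.
case: (ex_minnP exP) => [[|k] /asboolP[u up uz] kmin].
  by case: (yp u up); move: uz; rewrite expr0 mul1r.
(* [k.+1] is the least exponent whose power of [z] kills [y] locally modulo [q], so [z ^+ k * y]
   survives and [z] kills it. *)
exists (z ^+ k * y); split=> [w wp wz|].
  suff /kmin : P k by rewrite ltnn.
  by apply/asboolP; exists w.
exists (u * t); first exact: prime_notinM.
move=> x; rewrite inE => /predU1P[->|/ty tx].
  by rewrite -mulrA mulrCA; apply: qdvd_mull; rewrite mulrA -exprS.
by rewrite -mulrA [x * _]mulrCA [t * _]mulrCA; do 2!apply: qdvd_mull.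
Qed.

(** Every element of p is congruent modulo [q] to one of finitely many representatives in p, so
    [socle_mod] for these is enough; its factor [t] is absorbed into [y]. *)
Lemma exists_conductor : exists y, ~ qdvd y /\ forall z, z \in p -> qdvd (z * y).
Proof.
have [s sP] := residue_ring_reps K prime_q_char.
have [x|y [yp [t tp ty]]] := @socle_mod [seq x <- s | x \in p].
  by rewrite mem_filter => /andP[].
exists (t * y); split=> [|z pz]; first exact: yp.
have [w ws zw] := sP z; have -> : z = w + (z - w) by rewrite addrC subrK.
have pw : w \in p by rewrite -[w](subKr z) rpredB //; apply: qdvd_mem.
rewrite mulrDl; apply: qdvdD; last by rewrite mulrC; apply: qdvd_mull.
by rewrite mulrCA; apply: ty; rewrite mem_filter pw.
Qed.

(** By pigeonhole two of the [q * c ^+ k] differ by a multiple of [q], so [c ^+ j - c ^+ i] is an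
    integer [y] and [c] is a root of the monic 'X^j - 'X^i - y. *)
Lemma integral_of_bounded_powers (c : K) :
  (forall k, exists x : A, val x = q%:R * c ^+ k) -> c \in @integral_pred K.
Proof.
move=> /boolp.choice[u uE].
have [i [j [ltij [y yE]]]] := pigeonhole_mod prime_q_char u.
have q0 : q%:R != 0 :> K.
  by rewrite -(rmorph_nat (in_alg K)) fmorph_eq0 pnatr_eq0 -lt0n prime_gt0 ?prime_q_char.
have cE : c ^+ j - c ^+ i = val y.
  apply: (mulfI q0); rewrite mulrBr -!uE -[LHS](rmorphB val) yE.
  by rewrite raddfMn -[LHS]mulr_natl.
apply/asboolP; pose f : {poly K} := 'X^j - ('X^i + (val y)%:P).
have szf : (size ('X^i + (val y)%:P : {poly K})%R < size ('X^j : {poly K})%R)%N.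
  rewrite size_polyXn ltnS (leq_trans (size_polyD _ _)) // geq_max size_polyXn ltij.
  by rewrite (leq_trans (size_polyC_leq1 _)) // (leq_ltn_trans _ ltij).
apply: (@integral_root_monic _ _ _ _ f).
- by rewrite monicE lead_coefDl ?size_polyN // lead_coefXn.
- by rewrite /root !hornerE -cE subrKC subrr.
apply/integral_poly => k; rewrite coefB coefD !coefXn coefC.
apply: integral_sub; first exact: integral_nat.
apply: integral_add; first exact: integral_nat.
by case: ifP => _; [exact/asboolP/(valP y) | exact: integral0].
Qed.

Variable pi : A.
Hypothesis val_pi : valuation p pi = 1%N.

(** The junk value of [valuation] is 0, so the value 1 is a genuine exponent. *)
Lemma uniformizerP : pi \in idealX p 1 /\ pi \notin idealX p 2.
Proof.
pose S : set nat := [set v | pi \in idealX p v /\ pi \notin idealX p v.+1]%classic.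
suff : S 1%N by [].
have [[k Sk]|nS] := pselect (exists k, S k).
  by rewrite -val_pi; apply: (@xgetPex _ _ S); exists k.
by move: val_pi; rewrite /valuation xgetPN // => k Sk; apply: nS; exists k.
Qed.

(** Multiplication by [c = y / q] maps p into A and [pi] to some [x] outside p; then
    [x * z = pi * (c * z)]. *)
Lemma prime_locally_principal z : z \in p ->
  exists t s, t \notin p /\ t * z = pi * s.
Proof.
have [y [yq yp]] := exists_conductor; have [/idealX1_sub pp pNp2] := uniformizerP.
pose c : K := val y / q%:R.
have q0 : q%:R != 0 :> K.
  by rewrite -(rmorph_nat (in_alg K)) fmorph_eq0 pnatr_eq0 -lt0n prime_gt0 ?prime_q_char.
have cp u : u \in p -> exists w : A, val w = val u * c.
  move=> /yp[w wE]; exists w; apply: (mulIf q0).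
  by rewrite mulrA mulfVK // -[RHS](rmorphM val) wE raddfMn mulr_natr.
(* Otherwise [c] maps p into itself, so all [q * c ^+ k] are integers and [c] is integral, against
   the choice of [y]. *)
have [u [pu [w [wE wp]]]] : exists u, u \in p /\ exists w : A, val w = val u * c /\ w \notin p.
  apply: contrapT => Hn.
  have {Hn}cp' u : u \in p -> exists2 w : A, w \in p & val w = val u * c.
    move=> pu; have [w wE] := cp u pu; exists w => //; apply/negPn/negP => wp.
    by apply: Hn; exists u; split=> //; exists w.
  have cint : c \in @integral_pred K.
    apply: integral_of_bounded_powers => k.
    suff [x px xE] : exists2 x : A, x \in p & val x = q%:R * c ^+ k by exists x.
    elim: k => [|k [x px xE]].
      by exists q%:R; rewrite ?residue_char_mem // rmorph_nat mulr1.
    by have [w pw wE] := cp' x px; exists w; rewrite // wE xE exprSr mulrA.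
  apply: yq; exists (RingOfIntegers cint); apply: val_inj.
  by rewrite raddfMn -[RHS]mulr_natr /= divfK.
have comm a b a' b' : val a' = val a * c -> val b' = val b * c -> a' * b = a * b' :> A.
  by move=> aE bE; apply: val_inj; rewrite !rmorphM /= aE bE -mulrA [c * _]mulrC.
(* [w * pi = u * x] with [w] outside p: if [x] were in p, [pi] would be in its square. *)
have [x xE] := cp pi pp; have xp : x \notin p.
  apply: contra pNp2 => px; apply: (mem_primeX wp); rewrite (comm _ _ _ _ wE xE).
  by apply: idealM_mul => //; rewrite -[x]mulr1 idealM_mul.
move=> pz; have [z' zE] := cp z pz; exists x, z'; split=> //.
exact: comm.
Qed.

End Uniformizer.

(** If [D] clears the denominators of the minimal polynomial, of degree d, then multiplying its
    coefficient of index i by [D ^+ (d - i)] gives a monic integral polynomial with root [D * x]. *)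
Lemma integral_multiple (K : fieldExtType rat) (x : K) :
  exists2 D : nat, (0 < D)%N & D%:R * x \in @integral_pred K.
Proof.
have /polyOver1P[f fE] := minPolyOver 1 x.
have [g [c c0 gE]] := rat_poly_scale f.
set D := `|c|%N; pose mp := minPoly 1 x; pose d := (size mp).-1.
have ce i : exists e : int, D%:R * mp`_i = e%:~R :> K.
  (* The sign is there because [D] is the absolute value of [c]. *)
  exists ((-1) ^+ (c < 0)%R * g`_i); rewrite pmulrn abszEsign [in LHS]rmorphM [RHS]rmorphM /=.
  rewrite -mulrA; congr (_ * _); rewrite /mp fE gE coef_map coefZ coef_map.
  rewrite -(rmorph_int (in_alg K)) -[LHS]rmorphM mulrA divff ?intr_eq0 // mul1r.
  by rewrite rmorph_int.
have D0 : (0 < D)%N by rewrite absz_gt0.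
have mpm : mp \is monic by apply: monic_minPoly.
have szm : size mp = d.+1 by rewrite prednK // size_poly_gt0 monic_neq0.
have mpd : mp`_d = 1 by move/monicP: mpm; rewrite lead_coefE.
exists D => //; apply/asboolP.
pose h : {poly K} := \poly_(i < d.+1) (D%:R ^+ (d - i) * mp`_i).
have hd : h`_d = 1 by rewrite coef_poly ltnSn subnn mul1r.
apply: (@integral_root_monic _ _ _ _ h).
- have szh : size h = d.+1 by apply: size_poly_eq; rewrite subnn mul1r mpd oner_eq0.
  by rewrite monicE lead_coefE szh /= hd.
- rewrite /root horner_poly; apply/eqP.
  transitivity (D%:R ^+ d * mp.[x]); last by rewrite minPolyxx mulr0.
  rewrite horner_coef szm mulr_sumr; apply: eq_bigr => i _.
  by rewrite exprMn mulrACA -exprD subnK ?mulrA // -ltnS.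
apply/integral_poly => i; rewrite coef_poly; case: ltnP => [lti|_]; last exact: integral0.
move: lti; rewrite ltnS leq_eqVlt => /predU1P[->|lti].
  by rewrite subnn mul1r mpd; apply: integral1.
rewrite -(subnSK lti) exprSr -mulrA.
apply: integral_mul; first by rewrite -natrX; apply: integral_nat.
by have [e ->] := ce i; apply: integral_id.
Qed.

(** * The discrete valuation at the prime *)

Section Localization.
Variables (K : fieldExtType rat) (p : primeOf K) (q : nat).
Hypothesis q_char : q \in [pchar (residueField p)].
Local Notation A := (ringOfIntegers K).
Variable pi : A.
Hypothesis val_pi : valuation p pi = 1%N.
Local Notation P := (val pi).

Lemma notin_neq0 (t : A) : t \notin p -> val t != 0.
Proof.
apply: contraNneq => t0; have -> : t = 0 by apply: val_inj.
exact: rpred0.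
Qed.

Lemma uniformizer_neq0 : P != 0.
Proof.
have [_] := uniformizerP val_pi; apply: contraNneq => t0.
by have -> : pi = 0 by [apply: val_inj]; apply: idealX0.
Qed.
Let P0 := uniformizer_neq0.

Lemma uniformizer_mem : pi \in p.
Proof. by have [/idealX1_sub] := uniformizerP val_pi. Qed.

(** This is v(x) >= k: the fractional ideal generated by [pi ^ k] in the localization at p, for [k]
    of any sign and with 0 always included. *)
Definition val_ge (k : int) (x : K) :=
  exists s t : A, t \notin p /\ x = P ^ k * (val s / val t).

Lemma val_ge0 k : val_ge k 0.
Proof. by exists 0, 1; rewrite idealr1 rmorph0 mul0r mulr0. Qed.

Lemma val_geM k l x y : val_ge k x -> val_ge l y -> val_ge (k + l) (x * y).
Proof.
move=> [s [t [tp ->]]] [s' [t' [t'p ->]]]; exists (s * s'), (t * t').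
by rewrite prime_notinM //= expfzDr // mulrACA mulf_div.
Qed.

Lemma val_geD k x y : val_ge k x -> val_ge k y -> val_ge k (x + y).
Proof.
move=> [s [t [tp ->]]] [s' [t' [t'p ->]]]; exists (s * t' + s' * t), (t * t').
by rewrite prime_notinM //= -mulrDr addf_div ?notin_neq0.
Qed.

Lemma val_ge_int (x : A) : val_ge 0 (val x).
Proof. by exists x, 1; rewrite idealr1 rmorph1 divr1 mul1r. Qed.

Lemma val_geN k x : val_ge k x -> val_ge k (- x).
Proof.
move=> kx; rewrite -mulN1r -[k]add0r; apply: val_geM kx.
by rewrite -(rmorphN1 (val : A -> K)); apply: val_ge_int.
Qed.

Lemma val_ge_unif k : val_ge k (P ^ k).
Proof. by exists 1, 1; rewrite idealr1 divr1 mulr1. Qed.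

Lemma val_ge_le k l x : l <= k -> val_ge k x -> val_ge l x.
Proof.
move=> lk [s [t [tp ->]]]; exists (pi ^+ `|k - l|%N * s), t; split=> //.
have -> : P ^ k = P ^ l * P ^+ `|k - l|%N.
  by rewrite exprnP gez0_abs ?subr_ge0 // -expfzDr // subrKC.
by rewrite rmorphM rmorphXn /= -!mulrA.
Qed.

Lemma val_ge_prime (x : A) : x \in p -> val_ge 1 (val x).
Proof.
move=> /(prime_locally_principal q_char val_pi)[t [s [tp tx]]]; exists s, t; split=> //.
rewrite mulrA; apply: canRL (mulfK (notin_neq0 tp)) _.
by rewrite mulrC; move/(congr1 val): tx.
Qed.

Lemma val_ge_clear x : val_ge 0 x -> exists t s : A, t \notin p /\ val t * x = val s.
Proof.
move=> [s [t [tp ->]]]; exists t, s; split=> //.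
by rewrite expr0z mul1r mulrC divfK ?notin_neq0.
Qed.

Lemma val_geX k x n : val_ge k x -> val_ge (k * n%:Z) (x ^+ n).
Proof.
move=> kx; elim: n => [|n IHn].
  by rewrite mulr0 expr0; apply: (val_ge_int 1).
by rewrite exprS intS mulrDr mulr1; apply: val_geM.
Qed.

(** Up to an integer of K, [x] is the inverse of a natural number [N * q ^ e]. Here [N] is a unit at
    p, and [q] divides [t * pi ^+ i] for some [t] outside p, which bounds the valuation of its
    inverse. *)
Lemma val_ge_exists x : exists k, val_ge k x.
Proof.
have geM y z : (exists k, val_ge k y) -> (exists k, val_ge k z) -> exists k, val_ge k (y * z).
  by move=> [k ky] [l lz]; exists (k + l); apply: val_geM.
have [D D0 Dx] := integral_multiple x.
have natr_neq0 n : (0 < n)%N -> n%:R != 0 :> K.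
  by move=> n0; rewrite -(rmorph_nat (in_alg K)) fmorph_eq0 pnatr_eq0 -lt0n.
have q_pr := prime_q_char q_char.
have -> : x = (D%:R)^-1 * (D%:R * x) by rewrite mulKf ?natr_neq0.
apply: (geM); last by exists 0; apply: (val_ge_int (RingOfIntegers Dx)).
have [e [N [qN ->]]] : exists e N, ~~ (q %| N)%N /\ D = (N * q ^ e)%N.
  have [N] := pfactor_coprime q_pr D0; rewrite prime_coprime // => qN DE.
  by exists (logn q D), N.
rewrite natrM invfM natrX -exprVn; apply: (geM).
  exists 0; exists 1, N%:R; rewrite -residue_eq0 rmorph_nat -(dvdn_pcharf q_char) qN.
  by rewrite rmorph_nat expr0z mul1r div1r.
elim: e => [|e IHe]; first by exists 0; apply: (val_ge_int 1).
rewrite exprS; apply: (geM) => //.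
have [i [t [tp [w wE]]]] := prime_nilpotent_mod q_char uniformizer_mem.
exists (- i%:Z); exists w, t; split=> //.
have {}wE : val t * P ^+ i = val w * q%:R.
  by rewrite -rmorphXn -[LHS](rmorphM val) wE raddfMn mulr_natr.
have q0 := natr_neq0 _ (prime_gt0 q_pr).
apply: (mulIf q0); rewrite mulVf // -mulrA [_ / _ * _]mulrAC -wE [val t * _]mulrC.
by rewrite mulfK ?notin_neq0 // -exprnN mulVf // expf_neq0.
Qed.

Lemma reduce_val (x : A) : reduce p (val x) = residue p x.
Proof.
by rewrite -[val x]divr1 -(rmorph1 (val : A -> K)) reduceE ?idealr1 // residue1 divr1.
Qed.

Lemma reduce0 : reduce p 0 = 0.
Proof. by rewrite -(rmorph0 (val : A -> K)) reduce_val residue0. Qed.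

Lemma reduceM x y : val_ge 0 x -> val_ge 0 y ->
  reduce p (x * y) = reduce p x * reduce p y.
Proof.
move=> [s [t [tp ->]]] [s' [t' [t'p ->]]]; rewrite !expr0z !mul1r mulf_div.
by rewrite -!rmorphM !reduceE ?prime_notinM // !residueM mulf_div.
Qed.

Lemma reduceD x y : val_ge 0 x -> val_ge 0 y ->
  reduce p (x + y) = reduce p x + reduce p y.
Proof.
move=> [s [t [tp ->]]] [s' [t' [t'p ->]]]; rewrite !expr0z !mul1r.
rewrite addf_div ?notin_neq0 // -!rmorphM -rmorphD !reduceE ?prime_notinM //.
by rewrite residueD !residueM addf_div // residue_eq0.
Qed.

Lemma reduce_eq0 x : val_ge 0 x -> reduce p x = 0 <-> val_ge 1 x.
Proof.
move=> [s [t [tp xE]]]; rewrite expr0z mul1r in xE; split.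
  rewrite xE reduceE // => /eqP; rewrite mulf_eq0 invr_eq0 !residue_eq0 (negPf tp) orbF.
  move=> /val_ge_prime s1; rewrite -[1]addr0; apply: val_geM s1 _.
  by exists 1, t; rewrite tp rmorph1 expr0z mul1r div1r.
move=> [u [w [wp ->]]]; rewrite mulrA -rmorphM reduceE //.
have /eqP -> : residue p (pi * u) == 0 by rewrite residue_eq0 prime_mull ?uniformizer_mem.
by rewrite mul0r.
Qed.

Lemma val_ge_inv x : val_ge 0 x -> reduce p x != 0 -> val_ge 0 x^-1.
Proof.
move=> [s [t [tp ->]]]; rewrite expr0z mul1r reduceE // mulf_eq0 residue_eq0 negb_or.
by case/andP=> sp _; exists t, s; rewrite sp expr0z mul1r invf_div.
Qed.

Lemma val_ge1_1 : ~ val_ge 1 1.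
Proof.
move/(reduce_eq0 (val_ge_int 1)) => /eqP; rewrite reduce_val.
by rewrite residue1 oner_eq0.
Qed.

Lemma mem_idealX_val k (x : A) : x \in idealX p k <-> val_ge k%:Z (val x).
Proof.
split=> [|[s [t [tp xE]]]].
  elim: k x => [|k IHk] x; first by move=> _; apply: val_ge_int.
  move: x; apply: idealM_ind => [|x y|x y px /IHk ky].
  - exact: val_ge0.
  - exact: val_geD.
  - by rewrite rmorphM intS; apply: val_geM ky; apply: val_ge_prime.
(* [t * x] is a multiple of [pi ^+ k], and [t] can be cancelled. *)
apply: (mem_primeX tp); have -> : t * x = s * pi ^+ k; last first.
  by apply: idealX_stable; apply/idealX_exp/uniformizer_mem.
apply: val_inj; rewrite !rmorphM rmorphXn /= xE; rewrite -exprnP mulrC [RHS]mulrC -mulrA.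
by rewrite divfK // notin_neq0.
Qed.

(** If [a] were in all powers of p, the product of [a] and its inverse would have valuation at least
    1. Hence the junk value of [valuation] is not taken. *)
Lemma valuationP (a : A) : val a != 0 ->
  val_ge (valuation p a)%:Z (val a) /\ ~ val_ge (valuation p a).+1%:Z (val a).
Proof.
move=> a0; pose S : set nat :=
  [set v | a \in idealX p v /\ a \notin idealX p v.+1]%classic.
suff [k Sk] : exists k, S k.
  have [] : S (valuation p a) by apply: (@xgetPex _ _ S); exists k.
  by move=> /mem_idealX_val av /negP avS; split=> // /mem_idealX_val.
have [l al] := val_ge_exists (val a)^-1.
have exn : exists k, a \notin idealX p k.
  apply: contrapT => Hn; apply: val_ge1_1.
  have ak k : val_ge k%:Z (val a).
    by apply/mem_idealX_val/negPn/negP => ak; apply: Hn; exists k.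
  have := val_geM (ak `|1 - l|%N) al; rewrite divff //; apply: val_ge_le.
  by rewrite -lerBlDr abszE ler_norm.
case: (ex_minnP exn) => [[|k] ak kmin] //; exists k; split=> //.
by apply/negPn/negP => /kmin; rewrite ltnn.
Qed.

Lemma unit_part (a : A) (e := val a / P ^+ valuation p a) : val a != 0 ->
  [/\ val_ge 0 e, reduce p e != 0 & val_ge (- (valuation p a)%:Z) (val a)^-1].
Proof.
move=> a0; have [av aNv] := valuationP a0; set v := valuation p a in e av aNv *.
have e0 : val_ge 0 e.
  by rewrite -(subrr v%:Z) /e -exprVn; apply: val_geM => //; rewrite exprVn exprnN; apply: val_ge_unif.
have aE : val a = e * P ^ v%:Z by rewrite /e divfK // expf_neq0.
have re0 : reduce p e != 0.
  apply/eqP => /(reduce_eq0 e0) e1; apply: aNv; rewrite aE intS.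
  by apply: val_geM e1 _; apply: val_ge_unif.
split=> //; rewrite aE invfM -[- _]add0r; apply: val_geM; first exact: val_ge_inv.
by rewrite invr_expz; apply: val_ge_unif.
Qed.

End Localization.

(** * The weight filtration *)

(** Meant for products of initial forms, where only the indices divisible by [m] contribute. *)
Lemma sum_multiples (V : nmodType) (F : nat -> V) m j : (0 < m)%N ->
    (forall i, ~~ (m %| i)%N -> F i = 0) ->
  \sum_(i < (m * j).+1) F i = \sum_(l < j.+1) F (m * l)%N.
Proof.
move=> m_gt0 F0; elim: j => [|j IHj]; first by rewrite muln0 !big_ord1 muln0.
rewrite [RHS]big_ord_recr /= -IHj -!(big_mkord xpredT F) /=.
rewrite (@big_cat_nat _ _ _ (m * j).+1) //=; last by nia.
congr (_ + _); rewrite big_nat_recr /=; last by nia.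
rewrite big_nat big1 ?add0r // => i lti; apply: F0; apply/dvdnP => -[k ik].
by rewrite ik (mulnC k) !ltn_pmul2l // in lti; lia.
Qed.

(** By separability the cofactor of [gcdp Q f] in [Q] is prime to [f], yet it divides a power of
    [f], so it is constant. In other words, the quotient by [Q] is reduced. *)
Lemma separable_dvdp_exp (F : fieldType) (Q f : {poly F}) k :
  separable_poly Q -> Q %| f ^+ k -> Q %| f.
Proof.
move=> Qsep Qfk; have Q0 := separable_poly_neq0 Qsep.
set g := gcdp Q f; have gQ : g %| Q := dvdp_gcdl Q f.
have QE := divpK gQ; set h := Q %/ g in QE.
have /coprimepP co_hg : coprimep h g by apply: separable_coprime Qsep _; rewrite QE.
have co_hf : coprimep h f.
  apply/coprimepP => u uh uf; apply: co_hg => //.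
  by rewrite dvdp_gcd uf -QE dvdp_mulr.
have h1 : h %= 1.
  have /coprimepP := coprimep_expr k co_hf; apply=> //.
  by apply: dvdp_trans Qfk; rewrite -QE dvdp_mulr.
by rewrite -QE (eqp_dvdl _ (eqp_mulr g h1)) mul1r dvdp_gcdr.
Qed.

Lemma integral_root_exp (F : fieldType) (x : F) n :
  (0 < n)%N -> x ^+ n \in @integral_pred F -> x \in @integral_pred F.
Proof.
move=> n_gt0 /asboolP xn; apply/asboolP.
apply: (@integral_root_monic _ _ _ _ ('X^n - (x ^+ n)%:P)).
- exact: monicXnsubC.
- by rewrite /root !hornerE subrr.
apply/integral_poly => i; rewrite coefB coefXn coefC; apply: integral_sub.
  exact: integral_nat.
by case: ifP => _; [|exact: integral0].
Qed.

Section WeightFiltration.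
Variables (K : fieldExtType rat) (p : primeOf K) (q : nat).
Hypothesis q_char : q \in [pchar (residueField p)].
Local Notation A := (ringOfIntegers K).
Variable pi : A.
Hypothesis val_pi : valuation p pi = 1%N.
Local Notation P := (val pi).
Variables (m e : nat).
Hypotheses (m_gt0 : (0 < m)%N) (co_me : coprime m e).
Local Notation val_ge := (val_ge p pi).

Let P0 : P != 0 := uniformizer_neq0 val_pi.

(* [wval_ge l c] means m v(c) >= l. *)
Definition wval_ge (l : int) (c : K) := exists j : int, l <= m%:Z * j /\ val_ge j c.

Lemma wval_ge0 l : wval_ge l 0.
Proof. by exists `|l|; split; [nia | apply: val_ge0]. Qed.

Lemma wval_ge_le k l c : l <= k -> wval_ge k c -> wval_ge l c.
Proof. by move=> lk [j [kj cj]]; exists j; rewrite (le_trans lk). Qed.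

Lemma wval_geD l c c' : wval_ge l c -> wval_ge l c' -> wval_ge l (c + c').
Proof.
move=> [j [lj cj]] [j' [lj' cj']]; exists (Num.min j j'); split.
  by rewrite minEle; case: ifP.
by apply: val_geD => //; [apply: val_ge_le cj | apply: val_ge_le cj'] => //; rewrite ge_min lexx ?orbT.
Qed.

Lemma wval_ge_sum l (I : Type) (r : seq I) (S : pred I) (c : I -> K) :
  (forall i, S i -> wval_ge l (c i)) -> wval_ge l (\sum_(i <- r | S i) c i).
Proof.
move=> H; elim/big_rec: _ => [|i y Si]; first exact: wval_ge0.
by apply: wval_geD; apply: H.
Qed.

Lemma wval_geN l c : wval_ge l c -> wval_ge l (- c).
Proof. by move=> [j [lj cj]]; exists j; split=> //; apply: val_geN. Qed.

Lemma wval_geM k l c c' : wval_ge k c -> wval_ge l c' -> wval_ge (k + l) (c * c').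
Proof.
move=> [j [lj cj]] [j' [lj' cj']]; exists (j + j'); split; last exact: val_geM.
by rewrite mulrDr lerD.
Qed.

Lemma wval_ge_val j c : val_ge j c -> wval_ge (m%:Z * j) c.
Proof. by exists j. Qed.

(** The Gauss valuation on K[X] that gives X the value e / m, rescaled by [m]. *)
Definition wt_ge (k : int) (f : {poly K}) := forall i, wval_ge (k - e%:Z * i%:Z) f`_i.

Lemma wt_geD k f g : wt_ge k f -> wt_ge k g -> wt_ge k (f + g).
Proof. by move=> kf kg i; rewrite coefD; apply: wval_geD. Qed.

Lemma wt_geN k f : wt_ge k f -> wt_ge k (- f).
Proof. by move=> kf i; rewrite coefN; apply: wval_geN. Qed.

Lemma wt_geB k f g : wt_ge k f -> wt_ge k g -> wt_ge k (f - g).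
Proof. by move=> kf /wt_geN; apply: wt_geD. Qed.

Lemma wt_ge_le k l f : l <= k -> wt_ge k f -> wt_ge l f.
Proof. by move=> lk kf i; apply: wval_ge_le (kf i); rewrite lerB. Qed.

Lemma wt_geM k l f g : wt_ge k f -> wt_ge l g -> wt_ge (k + l) (f * g).
Proof.
move=> kf lg i; rewrite coefM; apply: wval_ge_sum => j _.
apply: wval_ge_le (wval_geM (kf j) (lg (i - j)%N)).
by have := ltn_ord j; nia.
Qed.

Lemma wt_geC k c : wval_ge k c -> wt_ge k c%:P.
Proof.
move=> kc i; rewrite coefC; case: eqP => [->|_]; last exact: wval_ge0.
by rewrite mulr0 subr0.
Qed.

Lemma wval_ge_1 : wval_ge 0 1.
Proof. by rewrite -(mulr0 m%:Z); apply: wval_ge_val; apply: (val_ge_int p pi 1). Qed.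

Lemma wt_geXn i : wt_ge (e%:Z * i%:Z) 'X^i.
Proof.
move=> j; rewrite coefXn; case: eqP => [->|_]; last exact: wval_ge0.
by rewrite subrr; apply: wval_ge_1.
Qed.

Lemma wt_ge_exp k f i : wt_ge k f -> wt_ge (k * i%:Z) (f ^+ i).
Proof.
move=> kf; elim: i => [|i IHi]; first by rewrite mulr0; apply/wt_geC/wval_ge_1.
by rewrite exprS intS mulrDr mulr1; apply: wt_geM.
Qed.

Lemma wt_ge_sum k (I : Type) (r : seq I) (S : pred I) (f : I -> {poly K}) :
  (forall i, S i -> wt_ge k (f i)) -> wt_ge k (\sum_(i <- r | S i) f i).
Proof. by move=> H i; rewrite coef_sum; apply: wval_ge_sum => j /H. Qed.

Lemma wt_val_ge k f j : wt_ge (m%:Z * k) f -> val_ge k (f`_(m * j) * P ^+ (e * j)).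
Proof.
move=> /(_ (m * j)%N)[l [kl fl]].
have := val_geM val_pi fl (val_ge_unif p pi (e * j)%N%:Z); apply: val_ge_le => //.
by nia.
Qed.

(* The initial form, for the grading in which X has weight e and the
   uniformizer has weight m; X ^ m / pi ^ e becomes the variable. *)
Definition init (f : {poly K}) : {poly residueField p} :=
  \poly_(j < size f) reduce p (f`_(m * j) * P ^+ (e * j)).

Lemma coef_init f j : (init f)`_j = reduce p (f`_(m * j) * P ^+ (e * j)).
Proof.
rewrite coef_poly; case: ltnP => // szf.
rewrite nth_default ?mul0r; last by rewrite (leq_trans szf) ?leq_pmull.
by rewrite reduce0.
Qed.

Lemma initD f g : wt_ge 0 f -> wt_ge 0 g -> init (f + g) = init f + init g.
Proof.
move=> f0 g0; apply/polyP => j; rewrite coefD !coef_init coefD mulrDl.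
by rewrite (@reduceD _ _ pi) //; apply: wt_val_ge; rewrite mulr0.
Qed.

Lemma initN f : wt_ge 0 f -> init (- f) = - init f.
Proof.
move=> f0; apply/eqP; rewrite -addr_eq0 -initD //; last exact: wt_geN.
rewrite addNr; apply/eqP/polyP => j; rewrite coef_init !coef0 mul0r.
by rewrite reduce0.
Qed.

Lemma reduce_sum (I : Type) (r : seq I) (S : pred I) (c : I -> K) :
    (forall i, S i -> val_ge 0 (c i)) ->
  reduce p (\sum_(i <- r | S i) c i) = \sum_(i <- r | S i) reduce p (c i).
Proof.
move=> H; have [] : val_ge 0 (\sum_(i <- r | S i) c i) /\
  reduce p (\sum_(i <- r | S i) c i) = \sum_(i <- r | S i) reduce p (c i); last by [].
elim/big_rec2: _ => [|i x y Si [y0 yE]].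
  by split; [exact: val_ge0 | exact: reduce0].
split; first by apply: val_geD => //; apply: H.
by rewrite (@reduceD _ _ pi) ?yE //; apply: H.
Qed.

(** In the coefficient of index [m * j] of the product, the terms whose index is not a multiple of
    [m] have positive valuation once normalized, so they reduce to 0. *)
Lemma initM f g : wt_ge 0 f -> wt_ge 0 g -> init (f * g) = init f * init g.
Proof.
move=> f0 g0; apply/polyP => j; rewrite coefM coef_init coefM mulr_suml.
pose F i := f`_i * g`_(m * j - i) * P ^+ (e * j).
(* The bound is 1 if [m] does not divide [i], and 0 otherwise: equality of [m * k] and [- (e * i)]
   would force [m] to divide [i], since [m] and [e] are coprime. *)
have Fd i : (i <= m * j)%N -> val_ge (~~ (m %| i)%N)%:Z (F i).
  move=> lei; have [k [kl fk]] := f0 i; have [l [ll gl]] := g0 (m * j - i)%N.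
  have := val_geM val_pi (val_geM val_pi fk gl) (val_ge_unif p pi (e * j)%N%:Z).
  apply: val_ge_le => //; case: (boolP (m %| i)%N) => [_|mi] /=; first by nia.
  have : m%:Z * k != - (e * i)%:Z.
    apply: contraNneq mi => mk; rewrite -(Gauss_dvdr i co_me).
    by apply/dvdnP; exists `|k|%N; nia.
  by nia.
have Fl l : (l <= j)%N -> F (m * l)%N =
    (f`_(m * l) * P ^+ (e * l)) * (g`_(m * (j - l)) * P ^+ (e * (j - l))).
  move=> lj; rewrite /F -mulnBr mulrACA; congr (_ * _).
  by rewrite -exprD -mulnDr subnKC.
rewrite reduce_sum; last first.
  by move=> i _; apply: val_ge_le (Fd i _) => //; rewrite -ltnS.
(* Extended by 0, so that the vanishing asked by [sum_multiples] holds at every index. *)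
pose G i := if (i <= m * j)%N then reduce p (F i) else 0.
rewrite (eq_bigr (fun i : 'I_(m * j).+1 => G i)); last first.
  by move=> i _; rewrite /G -ltnS ltn_ord.
rewrite sum_multiples // => [|i mi].
  apply: eq_bigr => l _; rewrite /G leq_mul2l -ltnS ltn_ord orbT.
  rewrite Fl -1?ltnS // (@reduceM _ _ pi) ?coef_init //; apply: wt_val_ge; by rewrite mulr0.
rewrite /G; case: ifP => // lei; apply/(reduce_eq0 q_char val_pi).
  by apply: val_ge_le (Fd i lei).
by have := Fd i lei; rewrite mi.
Qed.

(** [init] sees the coefficients of index divisible by [m]. At the other indices weight 0 is
    excluded by coprimality, so weight >= 0 already means weight >= 1. *)
Lemma init_eq0 f : wt_ge 0 f -> init f = 0 <-> wt_ge 1 f.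
Proof.
move=> f0; split=> [if0 i|f1]; last first.
  apply/polyP => j; rewrite coef_init coef0; apply/(reduce_eq0 q_char val_pi).
    by apply: wt_val_ge; rewrite mulr0.
  have [l [ll fl]] := f1 (m * j)%N.
  have := val_geM val_pi fl (val_ge_unif p pi (e * j)%N%:Z); apply: val_ge_le => //.
  by nia.
have [/dvdnP[j ->]|mi] := boolP (m %| i)%N; last first.
  have [k [kl fk]] := f0 i; exists k; split=> //.
  have : m%:Z * k != - (e * i)%:Z.
    apply: contraNneq mi => mk; rewrite -(Gauss_dvdr i co_me).
    by apply/dvdnP; exists `|k|%N; nia.
  by nia.
have : val_ge 1 (f`_(m * j) * P ^+ (e * j)).
  apply/(reduce_eq0 q_char val_pi); first by apply: wt_val_ge; rewrite mulr0.
  by rewrite -coef_init if0 coef0.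
move=> /(val_geM val_pi)/(_ (val_ge_unif p pi (- (e * j)%N%:Z))).
rewrite -mulrA -exprnN divff ?expf_neq0 // mulr1 => fj.
by exists (1 - (e * j)%N%:Z); split; [nia | rewrite (mulnC j)].
Qed.

Lemma initC c : init c%:P = (reduce p c)%:P.
Proof.
apply/polyP => -[|j]; rewrite coef_init !coefC ?muln0 ?mulr1 //.
rewrite muln_eq0 (gtn_eqF m_gt0) mul0r.
by rewrite reduce0.
Qed.

Lemma init_lift (h : {poly residueField p}) : exists2 f, wt_ge 0 f & init f = h.
Proof.
exists (\sum_(j < size h) (val (repr h`_j) * P ^- (e * j))%:P * 'X^(m * j)).
  apply: wt_ge_sum => j _.
  have -> : 0 = (m%:Z * (0 - (e * j)%N%:Z)) + e%:Z * (m * j)%N%:Z by nia.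
  apply: wt_geM (wt_geXn _); apply/wt_geC/wval_ge_val/val_geM => //.
    exact: val_ge_int.
  by rewrite exprnN; apply: val_ge_unif.
apply/polyP => j; rewrite coef_init coef_sum.
under eq_bigr do rewrite coefCM coefXn eqn_pmul2l //.
have [ltj|lej] := ltnP j (size h); last first.
  rewrite nth_default // big1 ?mul0r => [|i _]; last first.
    by rewrite gtn_eqF ?mulr0 // (leq_trans (ltn_ord i)).
  by rewrite reduce0.
rewrite (bigD1 (Ordinal ltj)) //= eqxx big1 => [|i].
  by rewrite addr0 mulr1 divfK ?expf_neq0 // reduce_val /residue reprK.
by rewrite -val_eqE /= eq_sym => /negPf ->; rewrite mulr0.
Qed.

(** * The binomial and its initial form *)

Variables (a : A) (d n : nat).
Hypotheses (d_gt0 : (0 < d)%N) (nE : n = (m * d)%N).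
Hypotheses (a_neq0 : val a != 0) (val_a : valuation p a = (e * d)%N).

Let n_gt0 : (0 < n)%N. Proof. by rewrite nE muln_gt0 m_gt0. Qed.

Local Notation Phi := ('X^n - (val a)%:P : {poly K}).
Local Notation Q := ('X^d - (reduce p (val a / P ^+ (e * d)))%:P : {poly residueField p}).

(** 'X^n and [a] both have weight [e * n = m * (e * d)], which the factor brings to 0. *)
Lemma wt_binomial : wt_ge 0 ((P ^- (e * d))%:P * Phi).
Proof.
have nE' : m%:Z * (- (e * d)%N%:Z) + e%:Z * n%:Z = 0 by rewrite nE; nia.
rewrite -[X in wt_ge X _]nE'; apply: wt_geM.
  by apply/wt_geC/wval_ge_val; rewrite exprnN; apply: val_ge_unif.
apply: wt_geB (wt_geXn n) _; apply: wt_geC.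
have -> : e%:Z * n%:Z = m%:Z * (e * d)%N%:Z by rewrite nE; nia.
apply: wval_ge_val; rewrite -val_a.
by have [] := valuationP q_char val_pi a_neq0.
Qed.

Lemma init_binomial : init ((P ^- (e * d))%:P * Phi) = Q.
Proof.
apply/polyP => j; rewrite coef_init coefCM !coefB !coefXn !coefC nE.
rewrite eqn_pmul2l // muln_eq0 (gtn_eqF m_gt0) /=.
have [->|j0] := eqVneq j 0%N.
  rewrite (ltn_eqF d_gt0) !sub0r muln0 mulr1 mulrN mulrC.
  have [c0 _ _] := unit_part q_char val_pi a_neq0; rewrite val_a in c0.
  apply/eqP; rewrite -addr_eq0 -(@reduceD _ _ pi) //; last exact: val_geN.
  by rewrite addNr reduce0.
rewrite !subr0; have [->|jd] := eqVneq j d; last by rewrite mulr0 mul0r reduce0.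
by rewrite mulr1 mulVf ?expf_neq0 // -(rmorph1 (val : A -> K)) reduce_val residue1.
Qed.

(** Descending induction on the index: the coefficient of [g] at i is that of [Phi * g] at i + n
    plus [a] times that of [g] at i + n. The counter [N] bounds [size g - i]. *)
Lemma wt_divisor k g : wt_ge k (Phi * g) -> wt_ge (k - e%:Z * n%:Z) g.
Proof.
move=> kg i; move: {2}(size g) (leq_addl i (size g)) => N.
elim: N i => [|N IHN] i szg.
  by rewrite addn0 in szg; rewrite nth_default //; apply: wval_ge0.
have -> : g`_i = (Phi * g)`_(i + n) + val a * g`_(i + n).
  by rewrite mulrBl coefB coefXnM coefCM subrK ltnNge leq_addl addnK.
apply: wval_geD.
  by apply: wval_ge_le (kg (i + n)%N); nia.
have [va _] := valuationP q_char val_pi a_neq0.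
apply: wval_ge_le (wval_geM (wval_ge_val va) (IHN (i + n)%N _)).
  by rewrite val_a nE; nia.
by move: szg n_gt0; lia.
Qed.

Hypothesis Q_sep : separable_poly Q.
Hypothesis irr_a : irreducible_poly Phi.

(** * The induced filtration on the extension field *)

Variables (L : fieldExtType K) (alpha : L).
Hypothesis root_alpha : alpha ^+ n = (val a)%:A.
Hypothesis gen_alpha : (<<1; alpha>> = {:L})%VS.
Local Notation B := (ringOfIntegers L).
Local Notation iota := (in_alg L).
Hypothesis e_gt0 : (0 < e)%N.

Definition ev (f : {poly K}) : L := (map_poly iota f).[alpha].

Lemma evD f g : ev (f + g) = ev f + ev g.
Proof. by rewrite /ev rmorphD hornerD. Qed.

Lemma evN f : ev (- f) = - ev f.
Proof. by rewrite /ev rmorphN hornerN. Qed.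

Lemma evM f g : ev (f * g) = ev f * ev g.
Proof. by rewrite /ev rmorphM hornerM. Qed.

Lemma evX f k : ev (f ^+ k) = ev f ^+ k.
Proof. by rewrite /ev rmorphXn horner_exp. Qed.

Lemma evC c : ev c%:P = iota c.
Proof. by rewrite /ev map_polyC hornerC. Qed.

Lemma ev_var k : ev 'X^k = alpha ^+ k.
Proof. by rewrite /ev map_polyXn hornerXn. Qed.

Lemma ev_Phi : ev Phi = 0.
Proof. by rewrite evD evN evC ev_var root_alpha subrr. Qed.

Lemma ev_surj b : exists f, b = ev f.
Proof.
have : b \in <<1; alpha>>%VS by rewrite gen_alpha memvf.
by case/Fadjoin_polyP => g /polyOver1P[f ->] ->; exists f.
Qed.

Lemma ev_eq0 f : ev f = 0 -> Phi %| f.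
Proof.
move=> f0; apply/negPn/negP; rewrite -(irreducible_poly_coprime _ irr_a).
rewrite -(coprimep_map iota) => /coprimep_root/(_ (introT eqP ev_Phi)).
by rewrite -/(ev f) f0 eqxx.
Qed.

Lemma alpha_neq0 : alpha != 0.
Proof.
apply: contra_eq_neq root_alpha => ->; rewrite expr0n gtn_eqF // eq_sym.
by rewrite -in_algE fmorph_eq0.
Qed.

(* [filt k b] means m v(b) >= k for all the extensions v to L of the valuation
   at p. *)
Definition filt (k : int) (b : L) := exists2 f, wt_ge k f & b = ev f.

Lemma filt0 k : filt k 0.
Proof.
exists 0; last by rewrite /ev rmorph0 horner0.
by move=> i; rewrite coef0; apply: wval_ge0.
Qed.

Lemma filtD k b c : filt k b -> filt k c -> filt k (b + c).
Proof. by move=> [f kf ->] [g kg ->]; exists (f + g); rewrite ?evD //; apply: wt_geD. Qed.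

Lemma filtN k b : filt k b -> filt k (- b).
Proof. by move=> [f kf ->]; exists (- f); rewrite ?evN //; apply: wt_geN. Qed.

Lemma filt_sum k (I : Type) (r : seq I) (S : pred I) (b : I -> L) :
  (forall i, S i -> filt k (b i)) -> filt k (\sum_(i <- r | S i) b i).
Proof.
move=> H; elim/big_rec: _ => [|i y Si]; first exact: filt0.
by apply: filtD; apply: H.
Qed.

Lemma filtM k l b c : filt k b -> filt l c -> filt (k + l) (b * c).
Proof. by move=> [f kf ->] [g kg ->]; exists (f * g); rewrite ?evM //; apply: wt_geM. Qed.

Lemma filtX k b i : filt k b -> filt (k * i%:Z) (b ^+ i).
Proof. by move=> [f kf ->]; exists (f ^+ i); rewrite ?evX //; apply: wt_ge_exp. Qed.

Lemma filt_le k l b : l <= k -> filt k b -> filt l b.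
Proof. by move=> lk [f kf ->]; exists f => //; apply: wt_ge_le kf. Qed.

Lemma filt_scalar j c : val_ge j c -> filt (m%:Z * j) (iota c).
Proof. by move=> cj; exists c%:P; rewrite ?evC //; apply/wt_geC/wval_ge_val. Qed.

Lemma filt_int (x : A) : filt 0 (iota (val x)).
Proof. by rewrite -(mulr0 m%:Z); apply/filt_scalar/val_ge_int. Qed.

Lemma filt_alpha : filt e%:Z alpha.
Proof.
exists 'X^1; last by rewrite ev_var.
by rewrite -[e%:Z]mulr1; apply: wt_geXn.
Qed.

(** The inverse of [alpha] is [alpha ^+ n.-1 / a], of weight [e * (n - 1) - m * e * d = - e]. *)
Lemma filt_alphaV : filt (- e%:Z) alpha^-1.
Proof.
have -> : alpha^-1 = alpha ^+ n.-1 * iota (val a)^-1.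
  rewrite fmorphV /= -root_alpha -{2}(prednK n_gt0) exprS invfM mulrCA divff ?mulr1 //.
  by rewrite expf_neq0 ?alpha_neq0.
have [_ _ av] := unit_part q_char val_pi a_neq0; rewrite val_a in av.
apply: filt_le (filtM (filtX n.-1 filt_alpha) (filt_scalar av)).
have := n_gt0; rewrite nE; nia.
Qed.

Lemma filt_exists b : exists k, filt k b.
Proof.
have [f ->] := ev_surj b; rewrite /ev horner_poly.
elim/big_rec: _ => [|i y _ [k ky]]; first by exists 0; apply: filt0.
have [j /filt_scalar cj] := val_ge_exists q_char val_pi f`_i.
set x := _ * _; suff [l lx] : exists l, filt l x.
  by exists (Num.min k l); apply: filtD; [apply: filt_le lx|apply: filt_le ky]; rewrite ge_min lexx ?orbT.
by exists (m%:Z * j + e%:Z * i%:Z); apply: filtM cj _; apply/filtX/filt_alpha.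
Qed.

(** [f] is [Phi * g], and [wt_divisor] bounds the weight of [g]; once both factors are normalized to
    weight >= 0, [init] is multiplicative on them. *)
Lemma init_ev_eq0 f : wt_ge 0 f -> ev f = 0 -> Q %| init f.
Proof.
move=> f0 /ev_eq0; rewrite dvdp_eq => /eqP; set g := f %/ Phi => fE.
have Pe : P ^+ (e * d) != 0 by rewrite expf_neq0.
have fE' : f = ((P ^- (e * d))%:P * Phi) * ((P ^+ (e * d))%:P * g).
  by rewrite mulrACA -polyCM mulVf // mul1r mulrC.
have g0 : wt_ge 0 ((P ^+ (e * d))%:P * g).
  rewrite fE mulrC in f0.
  have := wt_divisor f0.
  have := wt_geC (wval_ge_val (val_ge_unif p pi (e * d)%N%:Z)).
  move=> H1 /(wt_geM H1); apply: wt_ge_le => //.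
  by rewrite nE; nia.
rewrite fE' initM //; last exact: wt_binomial.
by rewrite init_binomial dvdp_mulr.
Qed.

(** The degree 0 part of the graded ring of L is k[y] / (Q). If [Q] divides [init f], subtracting
    from [f] a lift of the quotient times the normalized binomial keeps the value at [alpha] and
    raises the weight. *)
Lemma init_filt1 f : wt_ge 0 f -> Q %| init f <-> filt 1 (ev f).
Proof.
move=> f0; split=> [|[g g1 gE]]; last first.
  have g0 : wt_ge 0 g by apply: wt_ge_le g1.
  have /init_ev_eq0 : wt_ge 0 (f - g) by apply: wt_geB.
  rewrite evD evN gE subrr => /(_ erefl).
  suff -> : init (f - g) = init f by [].
  have ig : init g = 0 by apply/init_eq0.
  by rewrite initD ?initN // ?ig ?subr0 //; apply: wt_geN.
rewrite dvdp_eq => /eqP; set h := init f %/ _ => fE.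
have [g g0 gE] := init_lift h.
set Phi' := (P ^- (e * d))%:P * Phi.
have Phi'0 : wt_ge 0 Phi' by apply: wt_binomial.
have gP0 : wt_ge 0 (g * Phi') by rewrite -[0]addr0; apply: wt_geM.
have : wt_ge 1 (f - g * Phi').
  apply/init_eq0; first exact: wt_geB.
  rewrite initD //; last exact: wt_geN.
  by rewrite initN // initM // gE init_binomial -fE subrr.
exists (f - g * Phi') => //.
by rewrite evD evN !evM ev_Phi !mulr0 subr0.
Qed.

(** The ring k[y] / (Q) is reduced, [Q] being separable. *)
Lemma filt_nilpotent b k : filt 0 b -> filt 1 (b ^+ k) -> filt 1 b.
Proof.
move=> [f f0 ->]; rewrite -evX.
have fX i : wt_ge 0 (f ^+ i) by rewrite -(mul0r i%:Z); apply: wt_ge_exp.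
have initX : init (f ^+ k) = init f ^+ k.
  elim: k => [|k IHk]; last by rewrite !exprS initM // IHk.
  by rewrite !expr0 initC -(rmorph1 (val : A -> K)) reduce_val residue1.
move=> /(init_filt1 (fX k)); rewrite initX => /(separable_dvdp_exp Q_sep).
by move/(init_filt1 f0).
Qed.

Lemma uniformizer_exists : exists Pi : L, [/\ Pi != 0, filt 1 Pi & filt (- 1) Pi^-1].
Proof.
(* Bezout gives [e * x = m * y + 1], so [alpha ^+ x / pi ^+ y] has weight 1. *)
case: (egcdnP m e_gt0) => x y xy _.
have {}xy : (e * x)%N%:Z = (m * y)%N%:Z + 1.
  by rewrite mulnC xy gcdnC (eqnP co_me) mulnC -addn1 PoszD.
exists (alpha ^+ x * iota (P ^- y)); split.
- by rewrite mulf_neq0 ?expf_neq0 ?alpha_neq0 // fmorph_eq0 invr_neq0 // expf_neq0.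
- have := filtM (filtX x filt_alpha) (filt_scalar (val_ge_unif p pi (- y%:Z))).
  by rewrite -exprnN; apply: filt_le; lia.
rewrite invfM -exprVn fmorphV invrK.
have := filtM (filtX x filt_alphaV) (filt_scalar (val_ge_unif p pi y%:Z)).
by apply: filt_le; lia.
Qed.

(** If [b] has weight >= -N with N > 0, then [w = Pi ^+ N * b] has weight >= 0. The monic equation
    of [b], of degree k, gives [w ^+ k] weight >= 1, hence [w] too, and the bound for [b] improves
    by 1. *)
Lemma filt_integral b : b \in @integral_pred L -> filt 0 b.
Proof.
have [Pi [Pi0 Pi1 PiV]] := uniformizer_exists.
move=> /asboolP[g gm gb]; have [k kb] := filt_exists b.
have {k kb} : exists N : nat, filt (- N%:Z) b.
  by exists `|k|%N; apply: filt_le kb; lia.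
case; elim=> [//|N IHN] bN; apply: IHN; set N' : nat := N.+1 in bN.
pose w := Pi ^+ N' * b.
have w0 : filt 0 w.
  by apply: filt_le (filtM (filtX N' Pi1) bN); lia.
suff : filt 1 w.
  move=> w1; have -> : b = Pi^-1 ^+ N' * w by rewrite exprVn mulKf // expf_neq0.
  by apply: filt_le (filtM (filtX N' PiV) w1); rewrite /N'; lia.
set k := (size g).-1.
have szg : size g = k.+1 by rewrite prednK // size_poly_gt0 monic_neq0.
have gk : g`_k = 1 by move/monicP: gm; rewrite lead_coefE.
apply: (@filt_nilpotent _ k) => //.
have {gb} : \sum_(i < k) (g`_i)%:~R * b ^+ i + b ^+ k = 0.
  move/eqP: gb; rewrite horner_coef size_map_poly_id0; last by rewrite (monicP gm) oner_eq0.
  rewrite szg big_ord_recr /= coef_map gk mul1r => gb0; rewrite -[RHS]gb0; congr (_ + _).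
  by apply: eq_bigr => i _; rewrite coef_map.
rewrite addrC => /eqP; rewrite addr_eq0 => /eqP bk.
rewrite exprMn bk mulrN mulr_sumr; apply/filtN/filt_sum => i _.
have -> : (Pi ^+ N') ^+ k * ((g`_i)%:~R * b ^+ i) =
    (g`_i)%:~R * (Pi ^+ (N' * (k - i)) * w ^+ i).
  rewrite mulrCA; congr (_ * _).
  by rewrite /w exprMn mulrA -!exprM -exprD -mulnDr subnK // ltnW.
have gi : filt 0 (g`_i)%:~R.
  by rewrite -(rmorph_int iota) -(rmorph_int (val : A -> K)); apply: filt_int.
have := filtM gi (filtM (filtX (N' * (k - i)) Pi1) (filtX i w0)); apply: filt_le.
by have := ltn_ord i; rewrite /N'; nia.
Qed.

(** Each monomial can be treated alone: the n-th power of [f_i * alpha ^+ i] is [f_i ^+ n * a ^+ i],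
    of nonnegative valuation in K, and an n-th root of an integral element is integral. *)
Lemma filt_clear b : filt 0 b ->
  exists2 t : A, t \notin p & iota (val t) * b \in @integral_pred L.
Proof.
case=> f f0 ->; rewrite /ev horner_poly.
elim/big_rec: _ => [|i y _ [t tp ty]].
  by exists 1; rewrite ?idealr1 // mulr0 rpred0.
have [j [lej cj]] := f0 i.
have aj : val_ge 0 (f`_i ^+ n * val a ^+ i).
  have [va _] := valuationP q_char val_pi a_neq0; rewrite val_a in va.
  apply: val_ge_le (val_geM val_pi (val_geX val_pi n cj) (val_geX val_pi i va)) => //.
  by rewrite nE; nia.
have [t' [s [t'p st']]] := val_ge_clear aj.
exists (t * t'); first exact: prime_notinM.
rewrite rmorphM /= -!in_algE mulrDr; apply: rpredD; last first.
   rewrite mulrAC mulrC; apply: rpredM; last by [].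
  exact: (integral_pred_map iota t').
rewrite -mulrA; apply: rpredM; first exact: (integral_pred_map iota t).
apply: (integral_root_exp n_gt0).
have -> : (iota (val t') * (iota f`_i * alpha ^+ i)) ^+ n = iota (val (t' ^+ n.-1 * s)).
  rewrite rmorphM rmorphXn /= -st' !exprMn -exprM mulnC exprM root_alpha -!in_algE.
  by rewrite -!rmorphXn -!rmorphM /= -{1}(prednK n_gt0) exprSr !mulrA.
exact: (integral_pred_map iota).
Qed.

(** * Reduction of the ring of integers of L to k[y] / (Q) *)

Definition phi (b : B) : {poly residueField p} :=
  init (xget 0 [set f | wt_ge 0 f /\ val b = ev f]%classic).

Lemma phiP b : exists f, [/\ wt_ge 0 f, val b = ev f & phi b = init f].
Proof.
pose S : set {poly K} := [set f | wt_ge 0 f /\ val b = ev f]%classic.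
have [f f0 fE] : filt 0 (val b) by apply/filt_integral/valP.
by have [f0' fE'] : S (xget 0 S); [apply: (@xgetI _ _ S f) | exists (xget 0 S)].
Qed.

(** Two polynomials with value [b] differ by one vanishing at [alpha]. So [phi] is well defined
    modulo [Q], and all its properties are congruences. *)
Lemma phi_init b f : wt_ge 0 f -> val b = ev f -> Q %| phi b - init f.
Proof.
move=> f0 bf; have [g [g0 bg ->]] := phiP b.
have -> : init g - init f = init (g - f) by rewrite initD ?initN //; apply: wt_geN.
by apply: init_ev_eq0; [apply: wt_geB | rewrite evD evN -bf -bg subrr].
Qed.

Lemma phiD x y : Q %| phi (x + y) - (phi x + phi y).
Proof.
have [f [f0 xf ->]] := phiP x; have [g [g0 yg ->]] := phiP y.
rewrite -initD //; apply: phi_init; first exact: wt_geD.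
by rewrite evD -xf -yg.
Qed.

Lemma phiM x y : Q %| phi (x * y) - phi x * phi y.
Proof.
have [f [f0 xf ->]] := phiP x; have [g [g0 yg ->]] := phiP y.
rewrite -initM //; apply: phi_init; last by rewrite evM -xf -yg.
by rewrite -[0]addr0; apply: wt_geM.
Qed.

Lemma phi_scalar (x : A) : Q %| phi (roi_map iota x) - (residue p x)%:P.
Proof.
have -> : (residue p x)%:P = init (val x)%:P by rewrite initC reduce_val.
apply: phi_init; last by rewrite evC.
by rewrite -(mulr0 m%:Z); apply/wt_geC/wval_ge_val/val_ge_int.
Qed.

Lemma phi_surj h : exists x, Q %| phi x - h.
Proof.
have [f f0 fh] := init_lift h.
have [t tp tf] : exists2 t : A, t \notin p & iota (val t) * ev f \in @integral_pred L.
  by apply: filt_clear; exists f.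
have [s ts] := prime_inv tp.
(* The factor [t] makes the lift integral, and [s], its inverse modulo p, undoes its effect on the
   reduction. *)
exists (roi_map iota s * RingOfIntegers tf).
have st0 : wt_ge 0 (val (s * t))%:P.
  by rewrite -(mulr0 m%:Z); apply/wt_geC/wval_ge_val/val_ge_int.
have -> : h = init ((val (s * t))%:P * f).
  rewrite initM // initC fh reduce_val [s * t]mulrC.
  have /eqP : residue p (1 - t * s) == 0 by rewrite residue_eq0.
  by rewrite residueB residue1 => /subr0_eq <-; rewrite mul1r.
apply: phi_init; first by rewrite -[0]addr0; apply: wt_geM.
by rewrite evM evC !rmorphM /= mulrA.
Qed.

(** [Pi] is [t * x] with [x] of weight 1 and its inverse of weight -1, so weight >= i means
    divisibility by [Pi ^+ i] up to a factor prime to p. From here on the filtration is used only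
    through these properties. *)
Lemma uniformizer_above (j := roi_map iota) : exists Pi : B,
  [/\ Q %| phi Pi,
      forall b, Q %| phi b -> exists t w, t \notin p /\ j t * b = Pi * w,
      forall z, z \in p -> exists t w, t \notin p /\ j t * j z = Pi ^+ m * w
    & exists t w z, [/\ t \notin p, z \in p & j t * Pi ^+ m = j z * w]].
Proof.
have [x [x0 x1 xV]] := uniformizer_exists.
have [t tp tx] : exists2 t : A, t \notin p & iota (val t) * x \in @integral_pred L.
  by apply: filt_clear; apply: filt_le x1.
pose Pi := RingOfIntegers tx.
have Pi1 : filt 1 (val Pi) by rewrite -[1]add0r; apply: filtM x1; apply: filt_int.
have Q_filt b : Q %| phi b <-> filt 1 (val b).
  by have [f [f0 -> ->]] := phiP b; apply: init_filt1.
have divide i (b : B) : filt i%:Z (val b) ->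
    exists t' w, t' \notin p /\ j t' * b = Pi ^+ i * w.
  move=> bi; have bi0 : filt 0 (x^-1 ^+ i * val b).
    by apply: filt_le (filtM (filtX i xV) bi); lia.
  have [u up uw] := filt_clear bi0.
  exists (t ^+ i * u), (RingOfIntegers uw); split.
    by apply: prime_notinM up; apply: prime_notinX.
  rewrite [j _]rmorphM rmorphXn; apply: val_inj.
  rewrite !rmorphM !rmorphXn /= exprMn exprVn -!mulrA; congr (_ * _).
  by rewrite [RHS]mulrCA; congr (_ * _); rewrite mulVKf ?expf_neq0.
exists Pi; split.
- exact/Q_filt.
- by move=> b /Q_filt/(divide 1%N).
- move=> z zp; apply: divide.
  have := filt_scalar (val_ge_prime q_char val_pi zp).
  by rewrite mulr1.
(* [Pi ^+ m / pi] has weight >= 0, since [pi] has weight [m]. *)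
have [t' [s [t'p ts]]] : exists t' w, t' \notin p /\ j t' * Pi ^+ m = j pi * w.
  have PV := filt_scalar (val_ge_unif p pi (- 1)).
  have Pm : filt 0 (iota P^-1 * val Pi ^+ m).
    by have := filtM PV (filtX m Pi1); rewrite -[P ^ (- 1)]invr_expz expr1z; apply: filt_le; lia.
  have [u up uw] := filt_clear Pm.
  exists u, (RingOfIntegers uw); split=> //.
  apply: val_inj; rewrite !rmorphM rmorphXn /= mulrCA; congr (_ * _).
  by rewrite mulrA -!in_algE -rmorphM divff // rmorph1 mul1r.
by exists t', s, pi; split=> //; apply: uniformizer_mem.
Qed.

End WeightFiltration.

(** * The primes above a prime *)

Lemma primeOf_exists (F : fieldType) (S : {pred ringOfIntegers F}) :
    idealr_closed S -> prime_idealr_closed S -> (exists2 x, x \in S & x != 0) ->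
  exists P : primeOf F, (P : {pred _}) =i S.
Proof.
move=> Sid Spr S0.
pose I : prime_idealr (ringOfIntegers F) :=
  HB.pack S (isIdealr.Build _ S Sid) (isPrimeIdealrClosed.Build _ S Spr).
by exists (@PrimeOf _ I S0).
Qed.

Lemma prod_dvdp (F : fieldType) (T : eqType) (s : seq T) (g : T -> {poly F}) f :
    uniq s -> (forall i j, i != j -> coprimep (g i) (g j)) ->
    (forall i, g i %| f) -> \prod_(i <- s) g i %| f.
Proof.
move=> + co_g gf; elim: s => [|i s IHs] /=; first by rewrite big_nil dvd1p.
case/andP=> nis us; rewrite big_cons Gauss_dvdp ?gf ?IHs //.
rewrite big_seq; elim/big_rec: _ => [|j h js co_h]; first exact: coprimep1.
by rewrite coprimepMr co_h andbT co_g //; apply: contraNneq nis => ->.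
Qed.

(** * Extension of an ideal along a map of rings *)

Section IdealExtension.
Variables (R S : comNzRingType) (f : R -> S) (I : {pred R}).

Lemma idealExt_mul x z : z \in I -> x * f z \in idealExt f I.
Proof.
move=> Iz; apply/asboolP; exists [:: (x, z)]; first by rewrite /= Iz.
by rewrite big_seq1.
Qed.

Lemma idealExtD x y : x \in idealExt f I -> y \in idealExt f I -> x + y \in idealExt f I.
Proof.
move=> /asboolP[s sP ->] /asboolP[t tP ->]; apply/asboolP; exists (s ++ t).
  by rewrite all_cat sP.
by rewrite big_cat.
Qed.

Lemma idealExt_stable : mul_stable (idealExt f I).
Proof.
move=> r _ /asboolP[s sP ->]; apply/asboolP; exists [seq (r * u.1, u.2) | u <- s].
  by rewrite all_map.
by rewrite big_map mulr_sumr; apply: eq_bigr => u _; rewrite mulrA.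
Qed.

Lemma idealExt_sub (T : {pred S}) :
    0 \in T -> (forall x y, x \in T -> y \in T -> x + y \in T) -> mul_stable T ->
    (forall z, z \in I -> f z \in T) ->
  {subset idealExt f I <= T}.
Proof.
move=> T0 TD TM IT _ /asboolP[s /allP sP ->]; rewrite big_seq.
by elim/big_rec: _ => // u x /sP Iu Tx; apply/TD/Tx/TM/IT.
Qed.

End IdealExtension.

(** * Primes cut out by the irreducible factors of Q *)

Section PrimesAbove.
Variables (F E : fieldType) (iota : {rmorphism F -> E}) (p : primeOf F).
Local Notation A := (ringOfIntegers F).
Local Notation B := (ringOfIntegers E).
Local Notation k := (residueField p).
Local Notation j := (roi_map iota).
Variables (Q : {poly k}) (phi : B -> {poly k}).
Hypotheses (phiD : forall x y, Q %| phi (x + y) - (phi x + phi y))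
           (phiM : forall x y, Q %| phi (x * y) - phi x * phi y)
           (phi_scalar : forall x, Q %| phi (j x) - (residue p x)%:P)
           (phi_surj : forall h, exists x, Q %| phi x - h).

Section OnePrime.
Variable g : {poly k}.
Hypotheses (g_irr : irreducible_poly g) (gQ : g %| Q).

Lemma dvdp_congr (u w : {poly k}) : Q %| u - w -> (g %| u) = (g %| w).
Proof.
by move=> /(dvdp_trans gQ) guw; rewrite -[u](subrK w) dvdp_addr.
Qed.

Lemma modp_eqE (u w : {poly k}) : (g %| u - w) = (u %% g == w %% g).
Proof. by rewrite /dvdp modpD modpN subr_eq0. Qed.

Lemma phiD_dvd x y : (g %| phi (x + y)) = (g %| phi x + phi y).
Proof. exact: dvdp_congr. Qed.

Lemma phiM_dvd x y : (g %| phi (x * y)) = (g %| phi x * phi y).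
Proof. exact: dvdp_congr. Qed.

Lemma phi_scalar_dvd x : (g %| phi (j x)) = (x \in p).
Proof.
rewrite (dvdp_congr (phi_scalar x)) -residue_eq0.
have [->|x0] := eqVneq (residue p x) 0; first by rewrite dvdp0.
apply/negbTE/negP => /dvdp_leq; rewrite polyC_eq0 x0 => /(_ isT).
by rewrite size_polyC x0 leqNgt g_irr.1.
Qed.

Lemma phi0_dvd : g %| phi 0.
Proof. by rewrite -(rmorph0 j) phi_scalar_dvd rpred0. Qed.

Lemma phiB_dvd x y : (g %| phi (x - y)) = (g %| phi x - phi y).
Proof.
rewrite phiD_dvd; have gN : g %| phi (- y) + phi y.
  by rewrite -phiD_dvd addNr phi0_dvd.
have -> : phi x + phi (- y) = (phi x - phi y) + (phi (- y) + phi y).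
  by rewrite addrACA addNr addr0.
by rewrite dvdp_addl.
Qed.

Lemma irreducible_dvdpM (u w : {poly k}) : g %| u * w -> (g %| u) || (g %| w).
Proof.
move=> guw; have [//|/= gNu] := boolP (g %| u).
by rewrite -(Gauss_dvdpr _ (_ : coprimep g u)) // irreducible_poly_coprime.
Qed.

(** As k[y] / (g) is a domain, the kernel of the map to it is prime; it is nonzero because it
    contains the image of p. *)
Lemma prime_exists : exists P : primeOf E, (P : {pred _}) =i [pred x | g %| phi x].
Proof.
apply: primeOf_exists => [|x y|].
- split=> [||x y z]; rewrite !inE ?phi0_dvd //.
    by rewrite -(rmorph1 j) phi_scalar_dvd idealr1.
  by move=> gy gz; rewrite phiD_dvd dvdp_addr // phiM_dvd dvdp_mull.
- by rewrite !inE phiM_dvd => /irreducible_dvdpM.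
have [x px x0] := prime_ideal_neq0 p; exists (j x); first by rewrite inE phi_scalar_dvd.
apply: contra_neq x0 => /(congr1 val) /eqP; rewrite [val 0]rmorph0 fmorph_eq0 => /eqP x0.
exact: val_inj.
Qed.

Variable P : primeOf E.
Hypothesis PE : (P : {pred _}) =i [pred x | g %| phi x].

Lemma prime_lies_over : lies_over iota p P.
Proof. by move=> x; rewrite PE inE phi_scalar_dvd. Qed.

Lemma residue_eq x y : (residue P x == residue P y) = (g %| phi x - phi y).
Proof. by rewrite -subr_eq0 -residueB residue_eq0 PE inE phiB_dvd. Qed.

(** [psi] induces an isomorphism from k[y] / (g) to the residue field of P, inverse to the one given
    by [phi], and carries the monomial basis over. *)
Lemma residue_degree : has_degree (residue_map prime_lies_over) (size g).-1.
Proof.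
set d := (size g).-1; have szg : size g = d.+1 by rewrite prednK // ltnW // g_irr.1.
have /boolp.choice[l lE] := phi_surj.
have gl h : g %| phi (l h) - h := dvdp_trans gQ (lE h).
pose psi (h : {poly k}) := residue P (l h).
have phi_mod x u : Q %| phi x - u -> phi x %% g = u %% g.
  by move=> /(dvdp_trans gQ); rewrite modp_eqE => /eqP.
have psi_eq h h' : (psi h == psi h') = (g %| h - h').
  by rewrite residue_eq !modp_eqE !(phi_mod _ _ (lE _)).
have residue_psi x : residue P x = psi (phi x).
  by apply/eqP; rewrite residue_eq modp_eqE (phi_mod _ _ (lE _)).
have psiD h h' : psi (h + h') = psi h + psi h'.
  apply/eqP; rewrite -residueD residue_psi psi_eq modp_eqE (phi_mod _ _ (phiD _ _)).
  by rewrite !modpD !(phi_mod _ _ (lE _)).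
have psiM c h : psi (c%:P * h) = residue_map prime_lies_over c * psi h.
  have [x <-] := residue_surj c; rewrite residue_mapE -residueM residue_psi.
  apply/eqP; rewrite psi_eq modp_eqE (phi_mod _ _ (phiM _ _)).
  rewrite -[X in _ == X]modp_mul (phi_mod _ _ (lE _)) modp_mul [phi _ * _]mulrC.
  by rewrite -[X in _ == X]modp_mul (phi_mod _ _ (phi_scalar _)) modp_mul mulrC.
have psi_sum (c : 'I_d -> k) : psi (\sum_i (c i)%:P * 'X^i) =
    \sum_i residue_map prime_lies_over (c i) * psi 'X^i.
  elim/big_ind2: _ => [|h y h' y' <- <-|i _]; last exact: psiM.
    by apply: (addrI (psi 0)); rewrite -psiD !addr0.
  exact: psiD.
have coefE (c : 'I_d -> k) : \sum_i (c i)%:P * 'X^i = \poly_(i < d) (if insub i is Some i' then c i' else 0).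
  rewrite poly_def; apply: eq_bigr => i _; rewrite mul_polyC valK //.
exists (fun i => psi 'X^i) => y.
have [x <-] := residue_surj y; rewrite residue_psi.
have szm : (size (phi x %% g)%R <= d)%N by rewrite -ltnS -szg ltn_modp irredp_neq0.
(* The coordinates are read off the remainder modulo [g]. *)
exists [ffun i : 'I_d => (phi x %% g)`_i]; split.
  under eq_bigr do rewrite ffunE; rewrite -(psi_sum (fun i => (phi x %% g)`_i)).
  apply/eqP; rewrite psi_eq (_ : \sum_(i < d) _ = phi x %% g); first last.
    rewrite -[RHS]coefK [RHS]poly_def (big_ord_widen _ (fun i => (phi x %% g)`_i *: 'X^i) szm).
    rewrite [LHS](bigID (fun i : 'I_d => (i < size (phi x %% g)%R)%N)) /= [X in _ + X]big1 ?addr0.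
      by apply: eq_bigr => i _; rewrite mul_polyC.
    by move=> i; rewrite -leqNgt => szi; rewrite nth_default // polyC0 mul0r.
  by rewrite {1}(divp_eq (phi x) g) addrK dvdp_mulIr.
move=> c /eqP; rewrite -psi_sum psi_eq => gc; apply/ffunP => i; rewrite ffunE.
set s := \sum_i _ in gc.
have szs : (size s <= d)%N by rewrite /s coefE size_poly.
have : phi x %% g = s %% g.
  by apply/eqP; rewrite -subr_eq0 -modpN -modpD.
rewrite (modp_small (p := s)); last by rewrite szg ltnS.
by move=> ->; rewrite /s coefE coef_poly ltn_ord valK.
Qed.

End OnePrime.

Variables (r : nat) (gamma : 'I_r -> {poly k}).
Hypotheses (gamma_irr : forall i, irreducible_poly (gamma i))
  (QE : Q = \prod_(i < r) gamma i)
  (gamma_co : forall i j, i != j -> coprimep (gamma i) (gamma j)).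
Variables (e : nat) (Pi : B).
Hypothesis e_gt0 : (0 < e)%N.
Hypotheses
  (Pi_phi : Q %| phi Pi)
  (Pi_gen : forall b, Q %| phi b -> exists t w, t \notin p /\ j t * b = Pi * w)
  (p_Pi : forall z, z \in p -> exists t w, t \notin p /\ j t * j z = Pi ^+ e * w)
  (Pi_p : exists t w z, [/\ t \notin p, z \in p & j t * Pi ^+ e = j z * w]).

Lemma gamma_dvd i : gamma i %| Q.
Proof. by rewrite QE (bigD1 i) //= dvdp_mulr. Qed.

Lemma gamma_ndvd i i' : i != i' -> ~~ (gamma i %| gamma i').
Proof. by rewrite -irreducible_poly_coprime //; apply: gamma_co. Qed.

Variable P : 'I_r -> primeOf E.
Hypothesis PE : forall i, (P i : {pred _}) =i [pred x | gamma i %| phi x].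

(** A lift of [gamma i] works, since no other factor divides [gamma i]. *)
Lemma gamma_lift i : exists x, (x \in P i) /\ forall i', i' != i -> x \notin P i'.
Proof.
have [x xE] := phi_surj (gamma i); exists x; split=> [|i' ii'].
  by rewrite PE inE (dvdp_congr (gamma_dvd i) xE).
by rewrite PE inE (dvdp_congr (gamma_dvd i') xE) gamma_ndvd.
Qed.

Lemma primes_inj i i' : (P i : {pred _}) =i (P i' : {pred _}) -> i = i'.
Proof.
move=> ii'; apply/eqP/contraT => ne; have [x [xi xi']] := gamma_lift i'.
by have := xi' i ne; rewrite ii' xi.
Qed.

Local Notation prodP := (\big[@idealM B/ideal1]_(i < r) (P i : {pred _})).

Lemma prime_stable i : mul_stable (P i : {pred B}).
Proof. by move=> x y; apply: prime_mulr. Qed.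

Lemma prodP_sub i : {subset prodP <= P i}.
Proof.
have : i \in index_enum 'I_r by rewrite mem_index_enum.
elim: (index_enum _) => //= i' s IHs; rewrite inE big_cons => /predU1P[<-|/IHs sP] x.
  by move: x; apply: idealM_ind => [|x y|x y xP _]; rewrite ?rpred0 ?prime_mull //; apply: rpredD.
move: x; apply: idealM_ind => [|x y|x y _ /sP]; rewrite ?rpred0 //; first exact: rpredD.
exact: prime_mulr.
Qed.

Lemma prodP_phi b : b \in prodP -> Q %| phi b.
Proof.
move=> bP; rewrite QE; apply: prod_dvdp => [||i]; first exact: index_enum_uniq.
  by move=> i i'; apply: gamma_co.
by have := prodP_sub i bP; rewrite PE.
Qed.

(** Chinese remainder argument: a product of the lifts for the remaining primes lies in their
    product but not in P i, so it is invertible modulo P i. *)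
Lemma cap_prodP b : (forall i, b \in P i) -> b \in prodP.
Proof.
move=> bP; have := index_enum_uniq 'I_r; have /boolp.choice[l lP] := gamma_lift.
elim: (index_enum _) => [|i s IHs] /=; first by rewrite big_nil.
case/andP=> nis us; rewrite big_cons.
set J := \big[_/_]_(_ <- _) _; have {}IHs : b \in J by apply: IHs.
pose c := \prod_(i' <- s) l i'.
have cJ : c \in J by apply: bigideal_prod => i'; case: (lP i').
have cNi : c \notin P i.
  rewrite /c big_seq; elim/big_rec: _ => [|i' x i's xi]; first by rewrite idealr1.
  apply: prime_notinM => //; have [_ ->] // := lP i'.
  by apply: contraNneq nis => ->.
have [u ui] := prime_inv cNi.
(* In the first term [b] is in P i and [c * u] in J; in the second [1 - c * u] is in P i and [b] in
   J. *)
have -> : b = b * (c * u) + (1 - c * u) * b by rewrite mulrBl mul1r [b * _]mulrC subrKC.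
apply: idealMD; apply: idealM_mul => //.
by rewrite mulrC; apply: bigideal_stable cJ => i'; apply: prime_stable.
Qed.

Lemma scalar_prodP x : x \in p -> j x \in prodP.
Proof. by move=> xp; apply: cap_prodP => i; rewrite PE inE phi_scalar_dvd ?gamma_dvd. Qed.

Lemma prodPX_gen n b : b \in idealX prodP n ->
  exists t w, t \notin p /\ j t * b = Pi ^+ n * w.
Proof.
elim: n b => [|n IHn] b; first by exists 1, b; rewrite idealr1 rmorph1.
move: b; apply: idealM_ind => [|x y [t [w [tp tw]]] [t' [w' [tp' tw']]]|x y xP yP].
- by exists 1, 0; rewrite idealr1 !mulr0.
- exists (t * t'), (j t' * w + j t * w'); split; first exact: prime_notinM.
  rewrite rmorphM /= !mulrDr; congr (_ + _); last by rewrite -mulrA tw' mulrCA.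
  by rewrite mulrAC tw -mulrA [w * _]mulrC.
have [t [w [tp tw]]] := Pi_gen (prodP_phi xP); have [t' [w' [tp' tw']]] := IHn y yP.
exists (t * t'), (w * w'); split; first exact: prime_notinM.
by rewrite rmorphM /= mulrACA tw tw' mulrACA exprS.
Qed.

(** Up to factors prime to p, both sides are generated by [Pi ^+ e]. These factors cancel by
    [mem_cancel], as each side contains a power of any [j z] with [z] in p. *)
Lemma prime_factorization :
  idealExt j (p : {pred _}) =i \big[@idealM B/ideal1]_(i < r) idealX (P i : {pred _}) e.
Proof.
move=> b; rewrite (idealX_prod _ (fun i => P i : {pred B})); apply/idP/idP; move: b.
  apply: idealExt_sub; [exact: idealX0 | exact: idealXD | exact: idealX_stable |].
  move=> z /p_Pi[t [w [tp tw]]]; have [s ts] := prime_inv tp.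
  apply: (@mem_cancel _ _ (j t) (j s) _ e); [exact: idealXD | exact: idealX_stable | |].
    by rewrite -rmorphM -(rmorph1 j) -rmorphB idealX_exp // scalar_prodP.
  rewrite tw mulrC; apply: idealX_stable; apply: idealX_exp; apply: cap_prodP => i.
  by rewrite PE inE (dvdp_trans (gamma_dvd i)).
move=> b /prodPX_gen[t [w [tp tw]]]; have [t' [w' [z [t'p zp zw]]]] := Pi_p.
have [s ts] := prime_inv (prime_notinM t'p tp).
apply: (@mem_cancel _ _ (j (t' * t)) (j s) _ 1).
- exact: idealExtD.
- exact: idealExt_stable.
- rewrite expr1 -rmorphM -(rmorph1 j) -rmorphB /= -[j _]mul1r.
  exact: idealExt_mul.
rewrite rmorphM /= -mulrA tw mulrA zw -mulrA mulrC.
exact: idealExt_mul.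
Qed.

End PrimesAbove.

(** * Separability of the residue binomial, and assembly *)

Lemma separable_binomial (F : fieldType) (c : F) d :
  d%:R != 0 :> F -> c != 0 -> separable_poly ('X^d - c%:P).
Proof.
move=> d0 c0; have d_gt0 : (0 < d)%N by case: d d0 => //; rewrite eqxx.
rewrite separable_poly.unlock derivB derivC derivXn subr0.
apply/coprimepP => u uQ uQ'; rewrite -size_poly_eq1 -dvdp1.
(* 'X times the derivative, minus [d] times the binomial, is a nonzero constant. *)
have : u %| (c *+ d)%:P.
  have -> : (c *+ d)%:P = 'X * 'X^(d.-1) *+ d - ('X^d - c%:P) *+ d.
    by rewrite -exprS prednK // -mulrnBl subKr polyCMn.
  by rewrite dvdp_sub // -?mulrnAr ?dvdp_mull // -mulr_natr dvdp_mulr.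
by rewrite -mulr_natr -[X in X%:P]mulr1 polyCM mul_polyC dvdpZr // mulf_neq0.
Qed.

(** Otherwise 'X would be a proper factor of 'X^n. *)
Lemma irreducible_binomial_neq0 (F : fieldType) (c : F) n : (2 <= n)%N ->
  irreducible_poly ('X^n - c%:P) -> c != 0.
Proof.
move=> n2 [_ irr]; apply: contraTneq n2 => c0; rewrite c0 subr0 in irr *.
rewrite -ltnNge; have [->//|n_gt0] := posnP n.
have /irr : size ('X : {poly F}) != 1%N by rewrite size_polyX.
by rewrite -{1}['X]expr1 dvdp_exp2l // => /(_ isT)/eqp_size; rewrite size_polyX size_polyXn => -[<-].
Qed.

Theorem theorem6p1
  (K : fieldExtType rat) (n : nat) (n_ge2 : (2 <= n)%N)
  (a : ringOfIntegers K)
  (irr_a : irreducible_poly ('X^n - (val a)%:P : {poly K}))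
  (p : primeOf K) (q : nat) (q_char : q \in [pchar (residueField p)])
  (p_dvd_a : a \in (p : {pred _}))
  (q_ndvd : ~~ (q %| gcdn (valuation p a) n)%N)
  (pi : ringOfIntegers K) (val_pi : valuation p pi = 1%N)
  (r : nat) (gamma : 'I_r -> {poly residueField p})
  (irr_gamma : forall i, irreducible_poly (gamma i))
  (fact_gamma :
    'X^(gcdn (valuation p a) n)
      - (reduce p (val a / val pi ^+ valuation p a))%:P
    = \prod_(i < r) gamma i)
  (L : fieldExtType K) (alpha : L)
  (root_alpha : alpha ^+ n = (val a)%:A)
  (gen_alpha : (<<1; alpha>> = {:L})%VS) :
  exists P : 'I_r -> primeOf L,
    [/\ forall i j, (P i : {pred _}) =i (P j : {pred _}) -> i = j,
        idealExt (roi_map (in_alg L)) (p : {pred _}) =i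
          \big[@idealM (ringOfIntegers L)/ideal1]_(i < r)
            idealX (P i : {pred _}) (n %/ gcdn (valuation p a) n)
      & forall i, exists h : lies_over (in_alg L) p (P i),
          has_degree (residue_map h) (size (gamma i)).-1].
Proof.
have a0 := irreducible_binomial_neq0 n_ge2 irr_a.
have n_gt0 : (0 < n)%N := ltnW n_ge2.
have v_gt0 : (0 < valuation p a)%N.
  rewrite lt0n; apply/eqP => v0; have [_] := valuationP q_char val_pi a0.
  by rewrite v0; apply; exact: (val_ge_prime q_char val_pi p_dvd_a).
have [_ c0 _] := unit_part q_char val_pi a0.
have d_gt0 : (0 < gcdn (valuation p a) n)%N by rewrite gcdn_gt0 n_gt0 orbT.
have nE : n = (n %/ gcdn (valuation p a) n * gcdn (valuation p a) n)%N.
  by rewrite divnK ?dvdn_gcdr.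
have vE : valuation p a = (valuation p a %/ gcdn (valuation p a) n * gcdn (valuation p a) n)%N.
  by rewrite divnK ?dvdn_gcdl.
have co_me : coprime (n %/ gcdn (valuation p a) n) (valuation p a %/ gcdn (valuation p a) n).
  by rewrite coprime_sym /coprime -(eqn_pmul2r d_gt0) muln_gcdl -vE -nE mul1n.
(* The gcd and both quotients become variables tied by [n = m * d], [valuation p a = e * d] and the
   coprimality of [m] and [e]. *)
move: (gcdn _ _) (n %/ _)%N (valuation p a %/ _)%N => d m e in q_ndvd fact_gamma d_gt0 nE vE co_me *.
rewrite vE in fact_gamma c0.
(* Here [q] not dividing the gcd makes [d] nonzero in the residue field. *)
have Q_sep : separable_poly ('X^d - (reduce p (val a / val pi ^+ (e * d)))%:P).
  by apply: separable_binomial c0; rewrite -(dvdn_pcharf q_char).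
have e_gt0 : (0 < e)%N by move: v_gt0; rewrite vE muln_gt0 => /andP[].
have m_gt0 : (0 < m)%N by move: n_gt0; rewrite nE muln_gt0 => /andP[].
have gQ i : gamma i %| 'X^d - (reduce p (val a / val pi ^+ (e * d)))%:P.
  by rewrite fact_gamma (bigD1 i) //= dvdp_mulr.
have gamma_co i j : i != j -> coprimep (gamma i) (gamma j).
  move=> ij; apply: (separable_coprime Q_sep).
  by rewrite fact_gamma (bigD1 i) //= (bigD1 j) 1?eq_sym //= mulrA dvdp_mulr.
have phiD' := phiD q_char val_pi m_gt0 co_me d_gt0 nE a0 vE Q_sep irr_a root_alpha gen_alpha e_gt0.
have phiM' := phiM q_char val_pi m_gt0 co_me d_gt0 nE a0 vE Q_sep irr_a root_alpha gen_alpha e_gt0.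
have phi_scalar' := phi_scalar q_char val_pi m_gt0 co_me d_gt0 nE a0 vE Q_sep irr_a root_alpha gen_alpha e_gt0.
have phi_surj' := phi_surj q_char val_pi m_gt0 co_me d_gt0 nE a0 vE Q_sep irr_a root_alpha gen_alpha e_gt0.
have [Pi [Pi_phi Pi_gen p_Pi Pi_p]] :=
  uniformizer_above q_char val_pi m_gt0 co_me d_gt0 nE a0 vE Q_sep irr_a root_alpha gen_alpha e_gt0.
have /boolp.choice[P PE] i := prime_exists phiD' phiM' phi_scalar' (irr_gamma i) (gQ i).
exists P; split.
- by move=> i j; apply: (primes_inj phi_surj' irr_gamma fact_gamma gamma_co PE).
- exact: (prime_factorization phi_scalar' phi_surj' irr_gamma fact_gamma gamma_co
            Pi_phi Pi_gen p_Pi Pi_p PE).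
move=> i; exists (prime_lies_over phi_scalar' (irr_gamma i) (gQ i) (PE i)).
exact: (residue_degree phiD' phiM' phi_scalar' phi_surj' (irr_gamma i) (gQ i) (PE i)).
Qed.
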